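(* Let $a\ge 2$ be an integer and let $\Psi_a=\{\psi_n\}_{n\ge 0}$ be the generalized Walsh system of order $a$ on $[0,1)$. For any $0<\varepsilon<1$ there exist a measurable set $E\subset[0,1)$ with $|E|>1-\varepsilon$ and a series in the system $\Psi_a$ of the form $$\sum_{i=1}^\infty c_i\psi_i(x),\qquad |c_i|\downarrow 0$$ (i.e. $|c_i|$ is non-increasing in $i$ and tends to $0$), such that for any function $f\in L^1[0,1)$ one can find a function $g\in L^1[0,1)$ with $g(x)=f(x)$ for $x\in E$, and a series of the form $$\sum_{n=1}^\infty\delta_nc_n\psi_n(x),\qquad \delta_n\in\{0,1\}\ \text{for all } n,$$ which converges to $g$ in the $L^1[0,1)$ metric and satisfies $$\left\|\sum_{n=1}^m\delta_nc_n\psi_n\right\|_1\le 12\,\|f\|_1\qquad\text{for all } m\ge1.$$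
   Context: Fix an integer $a\ge 2$ and put $\omega_a=e^{2\pi i/a}$. The Rademacher system of order $a$ is defined by $\varphi_0(x)=\omega_a^k$ if $x\in\left[\frac{k}{a},\frac{k+1}{a}\right)$, $k=0,1,\dots,a-1$ (for $x\in[0,1)$), extended with period $1$, and for $n\ge 0$, $\varphi_n(x+1)=\varphi_n(x)=\varphi_0(a^n x)$. The generalized Walsh system $\Psi_a=\{\psi_n\}_{n\ge0}$ of order $a$ is defined by $\psi_0(x)=1$ and, if $n=\alpha_1a^{n_1}+\dots+\alpha_sa^{n_s}$ with $n_1>\dots>n_s\ge 0$ and $\alpha_j\in\{1,\dots,a-1\}$ (the base-$a$ expansion of $n\ge1$), $\psi_n(x)=\varphi_{n_1}^{\alpha_1}(x)\cdots\varphi_{n_s}^{\alpha_s}(x)$. Functions are complex-valued, $|E|$ denotes Lebesgue measure, and $\|\cdot\|_1$ is the $L^1[0,1)$ norm. The set $E$ and the coefficients $c_i$ depend only on $\varepsilon$ (and $a$), while $g$ and $(\delta_n)$ may depend on $f$. *)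

(* Defs.v *)
From HB Require Import structures.
From mathcomp Require Import all_boot all_order all_algebra.
From mathcomp Require Import all_classical all_reals all_analysis.
From mathcomp Require Import complex.

Set Implicit Arguments.
Unset Strict Implicit.
Unset Printing Implicit Defensive.

Import Order.TTheory GRing.Theory Num.Theory.
Import numFieldNormedType.Exports.

Local Open Scope classical_set_scope.
Local Open Scope ring_scope.
Local Open Scope complex_scope.

Section walsh.
Variables (R : realType) (a : nat).

Definition omega : R[i] :=
  cos (2 * pi / a%:R) +i* sin (2 * pi / a%:R).

(* With t the fractional part of x, Num.truncn (a * t) is the k such that
   t lies in [k / a, (k + 1) / a[. *)
Definition rademacher0 (x : R) : R[i] :=
  omega ^+ Num.truncn (a%:R * (x - (Num.floor x)%:~R)).

Definition rademacher (n : nat) (x : R) : R[i] :=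
  rademacher0 (a%:R ^+ n * x).

(* (n %/ a ^ k) %% a is the base-a digit of n at position k. For 1 < a we have
   n < a ^ n, so k < n covers all the nonzero digits; the positions with digit
   0 contribute a factor 1. *)
Definition walsh (n : nat) (x : R) : R[i] :=
  \prod_(k < n) rademacher k x ^+ ((n %/ a ^ k) %% a)%N.

Definition walsh_psum (delta : nat -> bool) (c : nat -> R[i]) (m : nat)
    (x : R) : R[i] :=
  \sum_(1 <= n < m.+1) (delta n)%:R * c n * walsh n x.

End walsh.

Section L1.
Variable R : realType.

(* R with the sigma-algebra of Lebesgue-measurable (not just Borel) sets, i.e.
   the domain of completed_lebesgue_measure. *)
Definition lebesgueType := caratheodory_type ((@wlength R idfun)^*)%mu.

Definition lebesgue_measurable (A : set R) : Prop :=
  measurable (A : set lebesgueType).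

(* Functions on [0, 1[ are represented by total functions on R, whose values
   outside [0, 1[ are irrelevant. *)
Definition L1 (f : R -> R[i]) : Prop :=
  (@completed_lebesgue_measure R).-integrable `[0, 1[
    (fun x => (complex.Re (f x))%:E) /\
  (@completed_lebesgue_measure R).-integrable `[0, 1[
    (fun x => (complex.Im (f x))%:E).

Definition L1norm (f : R -> R[i]) : \bar R :=
  (\int[@completed_lebesgue_measure R]_(x in `[0%R, 1%R[)
     (Normc.normc (f x))%:E)%E.

End L1.

(* Main.v *)
(* The characters give explicit high-frequency modifications of step functions.
   For an a-adic interval D of length a^-K, a value z and s >= K, the function
   z 1_D(x) (1 - a^v 1_[0, a^-v[({a^s x})) equals z on D outside a set of
   measure a^-K a^-v, vanishes off D and has L1 norm at most 2 |z| a^-K. By the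
   Dirichlet kernel identity its Walsh coefficients are supported on frequencies
   in [a^s, a^(s+v)[ and all have modulus |z| a^-K, and its partial sums are
   small when K is large with respect to v, because the Dirichlet kernel of order
   n <= a^K has L1 norm at most 2 a^(K/2). Hence every step function agrees, off a
   set of small measure, with a Walsh polynomial of arbitrarily high frequencies,
   with arbitrarily small coefficients of decreasing modulus, and with partial
   sums of norm at most 2 |f|_1 + eta: refine the step function and add the
   pieces in decreasing order of |z|.
   The universal series concatenates such polynomials for an enumeration (f_k) of
   the rational step functions in which each one recurs infinitely often; E is the
   complement of the exceptional sets. Given f, a greedy choice writes f as a sum
   of some of the f_k with small total norm, and the corresponding polynomials
   form the required subseries. *)

Require Import Defs.
From HB Require Import structures.
From mathcomp Require Import all_boot all_order all_algebra.
From mathcomp Require Import all_classical all_reals all_analysis.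
From mathcomp Require Import measurable_realfun.
From mathcomp Require Import complex.
From mathcomp Require Import ring lra zify.

Set Implicit Arguments.
Unset Strict Implicit.
Unset Printing Implicit Defensive.

Import Order.TTheory GRing.Theory Num.Theory.
Import numFieldNormedType.Exports.

Local Open Scope classical_set_scope.
Local Open Scope ring_scope.
Local Open Scope complex_scope.

(** * Walsh functions and Dirichlet kernels *)

(** The coefficients are fixed before [f] and their moduli must decrease over all indices, selected
    or not. Hence a one-cell polynomial carries coefficients of one common modulus at every index of
    its range, and a flag decides which terms occur; sorting the cells by |z| and capping each block
    by the last modulus of its predecessor gives monotonicity. The cells of a step function are
    treated one after another, so at each index at most one is incomplete. The finished ones cost at
    most 2 |z| a^-K each, and K = 2 r makes the unfinished one of order a^-r for fixed v. Each block
    differs from its f_k only on an exceptional set fixed in advance. Over the selected blocks these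
    differences form an absolutely convergent series in L^1, whose sum is g - f and vanishes on E.
    The norms selected greedily add up to at most 3 |f|_1; the factor 2 of the cell polynomials
    turns this into 6 |f|_1, and the errors eta cost at most one more |f|_1. The total 7 |f|_1 is
    within the required 12 |f|_1. *)

Section walsh_functions.
Variables (R : realType) (a : nat).
Hypothesis ha : (2 <= a)%N.

Lemma expa_gt0 k : (0 < a ^ k)%N. Proof. by rewrite expn_gt0 (ltn_trans _ ha). Qed.

Lemma omegaX k : omega R a ^+ k =
  cos (2 * pi / a%:R * k%:R) +i* sin (2 * pi / a%:R * k%:R).
Proof.
elim: k => [|k IHk]; first by rewrite mulr0 cos0 sin0.
rewrite exprS IHk /omega.
have -> : 2 * pi / a%:R * k.+1%:R = 2 * pi / a%:R + 2 * pi / a%:R * k%:R :> R.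
  by rewrite -[k.+1]add1n natrD mulrDr mulr1.
rewrite cosD sinD.
by apply/eqP; rewrite eq_complex/= eqxx/= addrC.
Qed.

Lemma normc_omega : Normc.normc (omega R a) = 1.
Proof. by rewrite /omega /Normc.normc cos2Dsin2 sqrtr1. Qed.

Lemma omegaXa : omega R a ^+ a = 1.
Proof.
rewrite omegaX divfK ?pnatr_eq0; last by case: a ha.
by rewrite mulr_natl cos2pi sin2pi.
Qed.

(** Half the angle, t, lies strictly between 0 and pi, so sin t > 0 and the real part cos 2t = 1 - 2
    sin^2 t is less than 1. *)
Lemma omegaX_neq1 k : (0 < k < a)%N -> omega R a ^+ k != 1.
Proof.
move=> /andP[k0 ka]; rewrite omegaX; apply/eqP => -[+ _].
have a0 : 0 < a%:R :> R by rewrite ltr0n (ltn_trans k0).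
pose t : R := pi / a%:R * k%:R.
have -> : 2 * pi / a%:R * k%:R = t + t by rewrite /t; field; rewrite gt_eqF.
have t0 : 0 < t by rewrite /t !mulr_gt0 ?invr_gt0 ?pi_gt0// ltr0n.
have tpi : t < pi.
  by rewrite /t -mulrA gtr_pMr ?pi_gt0// mulrC ltr_pdivrMr// mul1r ltr_nat.
have st : 0 < sin t by apply: sin_gt0_pi; rewrite t0 tpi.
rewrite cosD => h; have := cos2Dsin2 t.
have : 0 < sin t ^+ 2 by rewrite exprn_gt0.
rewrite !expr2; lra.
Qed.

Lemma omega_neq0 : omega R a != 0.
Proof.
apply/eqP => h; have := normc_omega; rewrite h Normc.normc0 => /esym/eqP.
by rewrite oner_eq0.
Qed.

(** Orthogonality of the characters of Z/a: the ratio is an a-th root of unity, and unless it is 1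
    its geometric sum vanishes. *)
Lemma sum_expr_omega (d e : nat) : (d < a)%N -> (e < a)%N ->
  \sum_(j < a) (omega R a ^+ d / omega R a ^+ e) ^+ j = (d == e)%:R *+ a.
Proof.
move=> da ea; have [->|de] := eqVneq d e.
  rewrite divff ?expf_neq0 ?omega_neq0//.
  by rewrite (eq_bigr (fun=> 1)) ?sumr_const ?card_ord// => i _; rewrite expr1n.
rewrite mul0rn; set z := _ / _.
have z1 : z != 1.
  apply: contra de => /eqP /(congr1 (fun w => w * omega R a ^+ e)).
  rewrite divfK ?expf_neq0 ?omega_neq0// mul1r.
  wlog le_ed : d e da ea {z} / (e <= d)%N.
    move=> wl h; have [le|/ltnW le] := leqP e d; first exact: wl.
    by rewrite eq_sym; apply: wl.
  rewrite -(subnK le_ed) exprD -[RHS]mul1r.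
  move/(mulIf (expf_neq0 _ omega_neq0)) => h.
  have [/eqP|dpos] := posnP (d - e).
    by rewrite subn_eq0 eqn_leq (subnK le_ed) le_ed andbT.
  have := @omegaX_neq1 (d - e); rewrite h eqxx dpos.
  by rewrite (leq_ltn_trans (leq_subr _ _) da) => /(_ isT).
have za : z ^+ a = 1.
  by rewrite expr_div_n -!exprM ![(_ * a)%N]mulnC !exprM omegaXa !expr1n divr1.
have := subrX1 z a; rewrite za subrr => /esym/eqP.
by rewrite mulf_eq0 subr_eq0 (negPf z1) /= => /eqP.
Qed.

(* [idx k x] is the number of the interval [j / a^k, (j + 1) / a^k[ containing
   [x >= 0]; its last base-a digit is the k-th digit of [x] after the point. *)
Definition idx (k : nat) (x : R) : nat := Num.truncn (a%:R ^+ k * x).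

Lemma expaR_gt0 k : 0 < (a%:R ^+ k : R).
Proof. by rewrite exprn_gt0// ltr0n (ltn_trans _ ha). Qed.

Lemma idx_eq k (x : R) (i : nat) : 0 <= x ->
  (idx k x == i) = (i%:R / a%:R ^+ k <= x < i.+1%:R / a%:R ^+ k).
Proof.
move=> x0; rewrite /idx truncn_eq ?mulr_ge0 ?(ltW (expaR_gt0 k))//.
by rewrite ler_pdivrMr ?expaR_gt0// ltr_pdivlMr ?expaR_gt0// ![x * _]mulrC.
Qed.

Lemma idx_lt k (x : R) : 0 <= x < 1 -> (idx k x < a ^ k)%N.
Proof.
move=> /andP[x0 x1]; rewrite /idx truncn_lt_nat ?mulr_ge0 ?(ltW (expaR_gt0 k))//.
by rewrite natrX gtr_pMr// expaR_gt0.
Qed.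

Lemma idx_point k i : idx k (i%:R / a%:R ^+ k) = i.
Proof. by rewrite /idx mulrC divfK ?gt_eqF ?expaR_gt0// natrK. Qed.

Lemma idx_divn k j (x : R) : 0 <= x -> idx k x = (idx (k + j) x %/ a ^ j)%N.
Proof.
move=> x0; apply/eqP; rewrite idx_eq//.
have := truncn_itv (x := a%:R ^+ (k + j) * x).
rewrite mulr_ge0 ?(ltW (expaR_gt0 _))// -/(idx (k + j) x) => /(_ isT) /andP[h1 h2].
set p := idx _ _ in h1 h2 *.
rewrite ler_pdivrMr ?expaR_gt0// ltr_pdivlMr ?expaR_gt0//.
rewrite -(ler_pM2r (expaR_gt0 j)) -[X in _ && X](ltr_pM2r (expaR_gt0 j)).
have -> : x * a%:R ^+ k * a%:R ^+ j = a%:R ^+ (k + j) * x by rewrite exprD; ring.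
rewrite -[a%:R ^+ j]natrX -!natrM; apply/andP; split.
  by apply: le_trans h1; rewrite ler_nat leq_trunc_div.
by apply: (lt_le_trans h2); rewrite ler_nat ltn_ceil// expa_gt0.
Qed.

(** A Rademacher function reads one digit: a times the fractional part of a^k x truncates to
    [idx k.+1 x] minus a times [idx k x], which is a remainder modulo a. *)
Lemma rademacherE k (x : R) : 0 <= x ->
  rademacher a k x = omega R a ^+ (idx k.+1 x %% a).
Proof.
move=> x0; rewrite /rademacher /rademacher0; congr (_ ^+ _).
have h := @idx_divn k 1 x x0; rewrite expn1 addn1 in h.
have y0 : 0 <= a%:R ^+ k * x by rewrite mulr_ge0 ?(ltW (expaR_gt0 _)).
have -> : (Num.floor (a%:R ^+ k * x))%:~R = (idx k x)%:R :> R.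
  by rewrite /idx truncn_floor y0 -[in LHS](gez0_abs (m := Num.floor _)) ?floor_ge0// -pmulrn.
rewrite mulrBr mulrA -exprS -natrM h [(a * _)%N]mulnC.
have p0 : 0 <= a%:R ^+ k.+1 * x by rewrite mulr_ge0 ?(ltW (expaR_gt0 _)).
have /andP[h1 h2] := truncn_itv p0; rewrite -/(idx k.+1 x) in h1 h2.
apply/truncn_def; rewrite lerBrDl ltrBlDl -!natrD addnS -divn_eq.
by rewrite h1 h2.
Qed.

Lemma normc_expr (z : R[i]) n : Normc.normc (z ^+ n) = Normc.normc z ^+ n.
Proof.
elim: n => [|n IHn]; first by rewrite !expr0 Normc.normc1.
by rewrite !exprS Normc.normcM IHn.
Qed.

Lemma normc_rademacher k (x : R) : Normc.normc (rademacher a k x) = 1.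
Proof. by rewrite /rademacher /rademacher0 normc_expr normc_omega expr1n. Qed.

Lemma normc_walsh n (x : R) : Normc.normc (walsh a n x) = 1.
Proof.
rewrite /walsh; apply: (big_ind (fun z => Normc.normc z = 1)).
- exact: Normc.normc1.
- by move=> u v hu hv; rewrite Normc.normcM hu hv mulr1.
- by move=> k _; rewrite normc_expr normc_rademacher expr1n.
Qed.

Lemma walshE n M (x : R) : (n <= M)%N ->
  walsh a n x = \prod_(k < M) rademacher a k x ^+ ((n %/ a ^ k) %% a)%N.
Proof.
move=> nM; rewrite /walsh.
rewrite -!(big_mkord xpredT (fun k => rademacher a k x ^+ ((n %/ a ^ k) %% a)%N)).
rewrite [in RHS](big_cat_nat (leq0n n) nM)/= [X in _ = _ * X]big1_seq ?mulr1// => k /andP[_].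
rewrite mem_index_iota => /andP[nk _].
by rewrite divn_small ?mod0n ?expr0// (leq_ltn_trans nk)// ltn_expl.
Qed.

(** The digits of [q * a ^ s] sit at positions at least [s] and those of [n] below [s]; nothing is
    carried, and every factor sees only one of the two. *)
Lemma walshD q s n (x : R) : (n < a ^ s)%N ->
  walsh a (q * a ^ s + n) x = walsh a (q * a ^ s) x * walsh a n x.
Proof.
move=> ns; pose M := (q * a ^ s + n)%N.
rewrite (@walshE _ M)// (@walshE (q * a ^ s) M) ?leq_addr//.
rewrite (@walshE n M) ?leq_addl// -big_split/=; apply: eq_bigr => k _.
rewrite -exprD; congr (_ ^+ _).
have [ks|sk] := ltnP k s.
  have -> : (a ^ s = a * a ^ (s - k).-1 * a ^ k)%N.
    by rewrite -expnS -expnD; congr (a ^ _)%N; lia.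
  rewrite mulnA divnMDl ?expa_gt0// mulnK ?expa_gt0// mulnA [(q * a)%N]mulnC -mulnA.
  by rewrite [(a * _)%N]mulnC modnMDl modnMl.
rewrite [(n %/ a ^ k)%N]divn_small ?(leq_trans ns) ?leq_pexp2l ?(ltn_trans _ ha)//.
rewrite mod0n addn0 -(subnKC sk) expnD !divnMA.
by rewrite divnMDl ?expa_gt0// mulnK ?expa_gt0// (divn_small ns) addn0.
Qed.

Lemma digit_mulX d s k : (d < a)%N ->
  ((d * a ^ s) %/ a ^ k %% a = if k == s then d else 0)%N.
Proof.
move=> da; have [kls|skk|->] := ltngtP k s.
- have -> : (a ^ s = a * a ^ (s - k).-1 * a ^ k)%N.
    by rewrite -expnS -expnD; congr (a ^ _)%N; lia.
  by rewrite mulnA mulnK ?expa_gt0// mulnCA modnMr.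
- rewrite -(subnKC (ltnW skk)) expnD divnMA mulnK ?expa_gt0//.
  rewrite divn_small ?mod0n// (leq_trans da)// -{1}(expn1 a) leq_pexp2l ?subn_gt0//.
  exact: ltn_trans ha.
- by rewrite mulnK ?expa_gt0// modn_small.
Qed.

Lemma walshX d s (x : R) : (d < a)%N ->
  walsh a (d * a ^ s) x = rademacher a s x ^+ d.
Proof.
move=> da; have [->|d0] := posnP d; first by rewrite mul0n expr0 /walsh big_ord0.
have sM : (s < d * a ^ s)%N.
  by rewrite (leq_trans (ltn_expl s ha))// leq_pmull.
rewrite /walsh (bigD1 (Ordinal sM))//= digit_mulX// eqxx.
rewrite big1 ?mulr1// => k; rewrite -val_eqE/= => /negPf ks.
by rewrite digit_mulX// ks expr0.
Qed.

Lemma walshDX d s n (x : R) : (d < a)%N -> (n < a ^ s)%N ->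
  walsh a (d * a ^ s + n) x = rademacher a s x ^+ d * walsh a n x.
Proof. by move=> da ns; rewrite walshD// walshX. Qed.

Lemma sum_mul_nat (V : nmodType) (m n : nat) (F : nat -> V) :
  \sum_(0 <= k < m * n) F k = \sum_(0 <= i < m) \sum_(0 <= j < n) F (i * n + j)%N.
Proof.
elim: m => [|m IHm]; first by rewrite mul0n !big_geq.
rewrite big_nat_recr//= -IHm (big_cat_nat (n := (m * n)%N))//=.
  congr (_ + _).
  by rewrite -{1}[(m * n)%N]add0n mulSn big_addn addnK; apply: eq_bigr => i _; rewrite addnC.
by rewrite leq_mul2r leqnSn orbT.
Qed.

(** The inverse plays the role of the complex conjugate, the values of [walsh] being unimodular. *)
Definition dirichlet (n : nat) (y x : R) : R[i] :=
  \sum_(0 <= k < n) (walsh a k y)^-1 * walsh a k x.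

(** Each further digit of the frequency contributes a full geometric sum in the ratio of two
    Rademacher values, equal to a or 0 according to whether [x] and [y] share the corresponding
    digit. The kernel of order 1 is constantly 1, which is why both points must start in the same
    unit interval. *)
Lemma dirichletX K (y x : R) : 0 <= y -> 0 <= x ->
  (idx 0 y == idx 0 x) ->
  dirichlet (a ^ K) y x = (a ^ K)%:R * (idx K x == idx K y)%:R.
Proof.
move=> y0 x0 i0; elim: K => [|K IHK].
  by rewrite /dirichlet expn0 big_nat1 /walsh !big_ord0 invr1 mulr1 eq_sym i0 mulr1.
rewrite /dirichlet expnS sum_mul_nat.
rewrite (eq_big_nat _ _ (F2 := fun i => (rademacher a K x / rademacher a K y) ^+ i
    * ((a ^ K)%:R * (idx K x == idx K y)%:R))); last first.
  move=> i /andP[_ ia]; rewrite -IHK /dirichlet big_distrr/=.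
  apply: eq_big_nat => j /andP[_ jK].
  rewrite !walshDX// invfM expr_div_n; ring.
rewrite -big_distrl/= big_mkord !rademacherE//.
rewrite sum_expr_omega ?ltn_mod ?(ltn_trans _ ha)//.
rewrite natrM -mulr_natl -!mulrA; congr (_ * _).
rewrite mulrCA; congr (_ * _); rewrite -natrM; congr (_%:R).
have hx := @idx_divn K 1 x x0; have hy := @idx_divn K 1 y y0.
rewrite expn1 addn1 in hx hy.
rewrite mulnb [in RHS](divn_eq (idx K.+1 x) a) [in RHS](divn_eq (idx K.+1 y) a) -hx -hy.
have mx : (idx K.+1 x %% a < a)%N by rewrite ltn_mod (ltn_trans _ ha).
have my : (idx K.+1 y %% a < a)%N by rewrite ltn_mod (ltn_trans _ ha).
congr nat_of_bool; apply/andP/eqP => [[/eqP-> /eqP->]//|e].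
split.
  have /(congr1 (modn^~ a)) := e; rewrite !modnMDl !modn_mod => ->//.
have /(congr1 (divn^~ a)) := e.
by rewrite !divnMDl ?(ltn_trans _ ha)// !divn_small// !addn0 => ->.
Qed.

(** The kernel at 0 of order [a ^ v], transported to scale [s]. The divisibility says that the last
    [v] digits of [idx (s + v) x] are 0, that is, the fractional part of a^s x is below a^-v. *)
Lemma sum_walsh_mulX s v (x : R) : 0 <= x ->
  \sum_(0 <= m < a ^ v) walsh a (m * a ^ s) x =
  (a ^ v)%:R * (a ^ v %| idx (s + v) x)%N%:R.
Proof.
move=> x0; elim: v => [|v IHv].
  by rewrite expn0 big_nat1 mul0n /walsh big_ord0 dvd1n mulr1.
rewrite expnS sum_mul_nat.
under eq_big_nat => i /andP[_ ia].
  under eq_big_nat => j /andP[_ jK].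
    rewrite mulnDl -mulnA -expnD [(v + s)%N]addnC walshDX//; last first.
      by rewrite expnD mulnC ltn_pmul2l ?expa_gt0.
    over.
  rewrite -big_distrr/= IHv.
  over.
rewrite -big_distrl/= big_mkord !rademacherE// -addnS.
have := @sum_expr_omega (idx (s + v.+1) x %% a) 0.
rewrite expr0 divr1 ltn_mod (ltn_trans _ ha)// => /(_ isT isT).
rewrite natrM => ->; rewrite -mulr_natl -!mulrA; congr (_ * _).
rewrite mulrCA; congr (_ * _); rewrite -natrM; congr (_%:R).
have hx := @idx_divn (s + v) 1 x x0.
rewrite expn1 addn1 -addnS in hx.
rewrite mulnb -/(dvdn _ _) hx; congr nat_of_bool.
set p := idx _ _.
have a0 := ltn_trans (ltn0Sn 0) ha.
apply/andP/idP => [[ap]|h].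
  by rewrite dvdn_divRL// mulnC.
have ap : (a %| p)%N by rewrite (dvdn_trans _ h)// dvdn_mulr.
by rewrite dvdn_divRL// mulnC.
Qed.

(** All nonzero digits of the index sit below position [n], so only the first [n] digits of [x]
    matter. Walsh functions are thus step functions, which yields their measurability. *)
Lemma walsh_idx n (x : R) : 0 <= x ->
  walsh a n x = walsh a n ((idx n x)%:R / a%:R ^+ n).
Proof.
move=> x0; rewrite /walsh; apply: eq_bigr => k _.
have y0 : 0 <= (idx n x)%:R / a%:R ^+ n :> R by rewrite divr_ge0// ltW// expaR_gt0.
rewrite !rademacherE//; congr (_ ^+ (_ %% _) ^+ _).
rewrite (@idx_divn k.+1 (n - k.+1) x)// (@idx_divn k.+1 (n - k.+1) _ y0).
by rewrite subnKC ?ltn_ord// idx_point.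
Qed.

End walsh_functions.

(** * Complex-valued integrable functions *)

Section complex_L1.
Context d (T : measurableType d) (R : realType).
Variables (mu : {measure set T -> \bar R}) (I : set T).
Hypotheses (mI : measurable I) (muI : mu I = 1%E).

Lemma Re_le_normc (z : R[i]) : `|complex.Re z| <= Normc.normc z.
Proof.
case: z => u v /=; rewrite -sqrtr_sqr ler_wsqrtr// lerDl sqr_ge0//.
Qed.

Lemma Im_le_normc (z : R[i]) : `|complex.Im z| <= Normc.normc z.
Proof.
case: z => u v /=; rewrite -sqrtr_sqr ler_wsqrtr// lerDr sqr_ge0//.
Qed.

Lemma normc_le_ReIm (z : R[i]) :
  Normc.normc z <= `|complex.Re z| + `|complex.Im z|.
Proof.
case: z => u v /=; rewrite -[leRHS]ger0_norm ?addr_ge0// -sqrtr_sqr ler_wsqrtr//.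
by rewrite sqrrD !real_normK ?num_real// addrAC lerDl mulrn_wge0// mulr_ge0.
Qed.

Lemma ler_normcD (u v : R[i]) :
  Normc.normc (u + v) <= Normc.normc u + Normc.normc v.
Proof. by rewrite -lecR rmorphD; exact: (ler_normD u v). Qed.

Lemma normcNr (u : R[i]) : Normc.normc (- u) = Normc.normc u.
Proof. by apply/complexI; exact: (normrN u). Qed.

Lemma normc_ge0 (z : R[i]) : 0 <= Normc.normc z.
Proof. by case: z => u v /=; rewrite sqrtr_ge0. Qed.

Definition measurable_funC (f : T -> R[i]) : Prop :=
  measurable_fun I (fun x => complex.Re (f x)) /\
  measurable_fun I (fun x => complex.Im (f x)).

Lemma measurable_fun_normc f : measurable_funC f ->
  measurable_fun I (fun x => Normc.normc (f x)).
Proof.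
move=> [mRe mIm].
have -> : (fun x => Normc.normc (f x)) =
    (fun x : T => Num.sqrt (complex.Re (f x) ^+ 2 + complex.Im (f x) ^+ 2)).
  by apply/funext => x; case: (f x).
apply: (measurableT_comp (f := @Num.sqrt R)).
  by apply: continuous_measurable_fun; exact: sqrt_continuous.
by apply: measurable_funD; apply: measurable_funX.
Qed.

Lemma eq_measurable_funC f g : measurable_funC f ->
  (forall x, I x -> f x = g x) -> measurable_funC g.
Proof.
move=> [m1 m2] fg; split; [apply: eq_measurable_fun m1|apply: eq_measurable_fun m2];
  by move=> x; rewrite inE => /fg ->.
Qed.

Lemma measurable_funC_cst c : measurable_funC (fun=> c).
Proof. by split; exact: measurable_cst. Qed.

Lemma measurable_funCD f g : measurable_funC f -> measurable_funC g ->
  measurable_funC (fun x => f x + g x).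
Proof.
move=> [f1 f2] [g1 g2]; split.
- have -> : (fun x => complex.Re (f x + g x)) = (fun x => complex.Re (f x) + complex.Re (g x)).
    by apply/funext => x; case: (f x) => ? ?; case: (g x).
  exact: measurable_funD.
- have -> : (fun x => complex.Im (f x + g x)) = (fun x => complex.Im (f x) + complex.Im (g x)).
    by apply/funext => x; case: (f x) => ? ?; case: (g x).
  exact: measurable_funD.
Qed.

Lemma measurable_funCM f g : measurable_funC f -> measurable_funC g ->
  measurable_funC (fun x => f x * g x).
Proof.
move=> [f1 f2] [g1 g2]; split.
- have -> : (fun x => complex.Re (f x * g x)) = (fun x : T =>
      complex.Re (f x) * complex.Re (g x) - complex.Im (f x) * complex.Im (g x)).
    by apply/funext => x; case: (f x) => ? ?; case: (g x).
  by apply: measurable_funB; apply: measurable_funM.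
- have -> : (fun x => complex.Im (f x * g x)) = (fun x : T =>
      complex.Re (f x) * complex.Im (g x) + complex.Im (f x) * complex.Re (g x)).
    by apply/funext => x; case: (f x) => ? ?; case: (g x).
  by apply: measurable_funD; apply: measurable_funM.
Qed.

Lemma measurable_funCB f g : measurable_funC f -> measurable_funC g ->
  measurable_funC (fun x => f x - g x).
Proof.
move=> mf mg; have := measurable_funCD mf (measurable_funCM (measurable_funC_cst (-1)) mg).
by move/eq_measurable_funC; apply => x _; rewrite mulN1r.
Qed.

Lemma measurable_funC_sum (J : Type) (r : seq J) (P : pred J) (f : J -> T -> R[i]) :
  (forall j, measurable_funC (f j)) ->
  measurable_funC (fun x => \sum_(j <- r | P j) f j x).
Proof.
move=> mf; elim: r => [|j r IHr].
  by apply: (eq_measurable_funC (measurable_funC_cst 0)) => x _; rewrite big_nil.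
have [Pj|Pj] := boolP (P j).
  apply: (eq_measurable_funC (measurable_funCD (mf j) IHr)) => x _.
  by rewrite big_cons Pj.
by apply: (eq_measurable_funC IHr) => x _; rewrite big_cons (negPf Pj).
Qed.

Local Open Scope ereal_scope.

Definition nrmC (f : T -> R[i]) : \bar R := \int[mu]_(x in I) (Normc.normc (f x))%:E.

Lemma nrmC_ge0 (f : T -> R[i]) : 0 <= nrmC f.
Proof. by apply: integral_ge0 => x _; rewrite lee_fin normc_ge0. Qed.

Lemma eq_nrmC (f g : T -> R[i]) : (forall x, I x -> f x = g x) ->
  nrmC f = nrmC g.
Proof.
by move=> fg; apply: eq_integral => x; rewrite inE => /fg ->.
Qed.

Lemma le_nrmCZ (k : R) (f g : T -> R[i]) : (0 <= k)%R ->
  measurable_funC f -> measurable_funC g ->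
  (forall x, (I x -> Normc.normc (f x) <= k * Normc.normc (g x))%R) ->
  nrmC f <= k%:E * nrmC g.
Proof.
move=> k0 mf mg fg; rewrite /nrmC -ge0_integralZl//; first last.
- by move=> x _; rewrite lee_fin normc_ge0.
- by apply/measurable_EFinP/measurable_fun_normc.
apply: ge0_le_integral => //.
- by move=> x _; rewrite lee_fin normc_ge0.
- by apply/measurable_EFinP/measurable_fun_normc.
- apply: measurable_funeM; exact/measurable_EFinP/measurable_fun_normc.
Qed.

Lemma nrmC_le_cst (k : R) (f : T -> R[i]) : (0 <= k)%R ->
  measurable_funC f ->
  (forall x, (I x -> Normc.normc (f x) <= k)%R) -> nrmC f <= k%:E.
Proof.
move=> k0 mf fk.
have := le_nrmCZ k0 mf (measurable_funC_cst (1%R : R[i])).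
rewrite [nrmC (fun=> 1%R)](_ : _ = 1) ?mule1; last first.
  rewrite -muI -[mu I]mul1e -(integral_cst mu mI); apply: eq_integral => x _.
  by rewrite Normc.normc1.
apply => x xI.
by rewrite Normc.normc1 mulr1 fk.
Qed.

Lemma nrmCD f g : measurable_funC f -> measurable_funC g ->
  nrmC (fun x => f x + g x)%R <= nrmC f + nrmC g.
Proof.
move=> mf mg; rewrite /nrmC -ge0_integralD//; first last.
- by apply/measurable_EFinP/measurable_fun_normc.
- by move=> x _; rewrite lee_fin normc_ge0.
- by apply/measurable_EFinP/measurable_fun_normc.
- by move=> x _; rewrite lee_fin normc_ge0.
apply: ge0_le_integral => //.
- by move=> x _; rewrite lee_fin normc_ge0.
- by apply/measurable_EFinP/measurable_fun_normc; exact: measurable_funCD.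
- by apply: emeasurable_funD; apply/measurable_EFinP/measurable_fun_normc.
- by move=> x _; rewrite -EFinD lee_fin ler_normcD.
Qed.

Lemma nrmC0 : nrmC (fun=> 0%R : R[i]) = 0.
Proof.
by rewrite /nrmC integral0_eq// => x _; rewrite Normc.normc0.
Qed.

Lemma nrmCB f g : measurable_funC f -> measurable_funC g ->
  nrmC (fun x => f x - g x)%R <= nrmC f + nrmC g.
Proof.
move=> mf mg.
have mNg : measurable_funC (fun x => - g x)%R.
  apply: (eq_measurable_funC (measurable_funCB (measurable_funC_cst 0%R) mg)) => x _.
  by rewrite sub0r.
rewrite (le_trans (nrmCD mf mNg))// leeD2l//.
rewrite -[leRHS]mul1e; apply: le_nrmCZ => // x _.
by rewrite normcNr mul1r.
Qed.

Lemma nrmC_sum (J : Type) (r : seq J) (P : pred J) (f : J -> T -> R[i]) :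
  (forall j, measurable_funC (f j)) ->
  nrmC (fun x => \sum_(j <- r | P j) f j x)%R <= \sum_(j <- r | P j) nrmC (f j).
Proof.
move=> mf; elim: r => [|j r IHr].
  rewrite (@eq_nrmC _ (fun=> 0%R)); first by rewrite nrmC0 big_nil.
  by move=> x _; rewrite big_nil.
rewrite big_cons; have [Pj|Pj] := boolP (P j).
  rewrite (@eq_nrmC _ (fun x => f j x + \sum_(j <- r | P j) f j x)%R).
    by rewrite (le_trans (nrmCD (mf j) (measurable_funC_sum _ _ mf)))// leeD2l.
  by move=> x _; rewrite big_cons Pj.
rewrite (@eq_nrmC _ (fun x => \sum_(j <- r | P j) f j x)%R)// => x _.
by rewrite big_cons (negPf Pj).
Qed.

(** Both directions rest on |Re z|, |Im z| <= |z| <= |Re z| + |Im z|. *)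
Lemma integrableCP (f : T -> R[i]) :
  (mu.-integrable I (fun x => (complex.Re (f x))%:E) /\
   mu.-integrable I (fun x => (complex.Im (f x))%:E)) <->
  measurable_funC f /\ nrmC f < +oo.
Proof.
split=> [[/integrableP[m1 i1] /integrableP[m2 i2]]|[mf fi]].
  have mf : measurable_funC f by split; apply/measurable_EFinP.
  split=> //; apply: (@le_lt_trans _ _
    (\int[mu]_(x in I) (`|(complex.Re (f x))%:E| + `|(complex.Im (f x))%:E|))).
    apply: ge0_le_integral => //.
    - by move=> x _; rewrite lee_fin normc_ge0.
    - by apply/measurable_EFinP/measurable_fun_normc.
    - by apply: emeasurable_funD; apply: measurableT_comp.
    - by move=> x _; rewrite -EFinD lee_fin normc_le_ReIm.
  rewrite ge0_integralD//; first exact: lte_add_pinfty.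
  - by apply: measurableT_comp.
  - by apply: measurableT_comp.
have ni : mu.-integrable I (EFin \o (fun x => Normc.normc (f x))).
  apply/integrableP; split; first by apply/measurable_EFinP/measurable_fun_normc.
  apply: le_lt_trans fi; rewrite le_eqVlt; apply/orP; left; apply/eqP.
  by apply: eq_integral => x _; rewrite /= ger0_norm// normc_ge0.
case: (mf) => m1 m2; split; apply: le_integrable ni => //.
- exact/measurable_EFinP.
- by move=> x _; rewrite /= lee_fin [leRHS]ger0_norm ?normc_ge0// Re_le_normc.
- exact/measurable_EFinP.
- by move=> x _; rewrite /= lee_fin [leRHS]ger0_norm ?normc_ge0// Im_le_normc.
Qed.

End complex_L1.

Section unit_interval.
Variable R : realType.
Local Notation mu := (@completed_lebesgue_measure R).
Local Notation I := (`[0%R, 1%R[%classic : set (lebesgueType R)).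

Lemma lebesgue_measurable_Borel (A : set R) :
  measurable (A : set (measurableTypeR R)) -> measurable (A : set (lebesgueType R)).
Proof. by move=> mA; apply: sub_caratheodory. Qed.

Lemma completed_lebesgue_measureE (A : set R) :
  completed_lebesgue_measure A = lebesgue_measure (A : set (measurableTypeR R)).
Proof. by []. Qed.

Lemma measurable_unit : measurable I.
Proof. by apply: lebesgue_measurable_Borel; exact: measurable_itv. Qed.

Lemma measure_unit : mu I = 1%E.
Proof.
rewrite completed_lebesgue_measureE lebesgue_measure_itv/= lte_fin ltr01.
by rewrite oppr0 adde0.
Qed.

End unit_interval.

(** * Absolutely convergent series in L^1 *)

Section L1_complete.
Context d (T : measurableType d) (R : realType).
Variables (mu : {measure set T -> \bar R}) (I : set T).
Hypotheses (mI : measurable I).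
Local Open Scope ereal_scope.

(** Dominated convergence under the sum of the |h_k|, integrable by monotone convergence. The
    vanishing of [H] is asserted at every point and not almost everywhere: it is what makes g equal
    to f on all of E. *)
Lemma L1_series_cvg (h : nat -> T -> R) (M : R) :
  (forall k, measurable_fun I (h k)) ->
  (forall n, \sum_(0 <= k < n) \int[mu]_(x in I) `|(h k x)%:E| <= M%:E) ->
  exists H : T -> R, [/\ mu.-integrable I (EFin \o H),
    (forall x, (forall k, h k x = 0%R) -> H x = 0%R) &
    \int[mu]_(x in I) `|(\sum_(0 <= k < n) h k x - H x)%:E| @[n --> \oo] --> 0].
Proof.
move=> mh hM.
pose G x := \sum_(0 <= k <oo) `|(h k x)%:E|.
have mG : measurable_fun I G.
  apply: ge0_emeasurable_sum => // k _.
  by apply: measurableT_comp => //; apply/measurable_EFinP.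
have G0 x : 0 <= G x by apply: nneseries_ge0 => k _ _; exact: abse_ge0.
have iG : mu.-integrable I G.
  apply/integrableP; split => //.
  under eq_integral do rewrite gee0_abs//.
  rewrite integral_nneseries//; last first.
    by move=> k; apply: measurableT_comp => //; apply/measurable_EFinP.
  apply: le_lt_trans (ltry M); apply: lime_le.
    by apply: is_cvg_nneseries => k _ _; exact: integral_ge0.
  exact: nearW.
pose S n x : R := (\sum_(0 <= k < n) h k x)%R.
(* The upper limit is measurable without any convergence, and [fine] gives it the value 0 where it
   is infinite. *)
pose H x : R := fine (limn_esup (fun n => (S n x)%:E)).
have mS n : measurable_fun I (S n) by apply: measurable_sum.
have mH : measurable_fun I H.
  apply: (measurableT_comp (f := fine)); first exact: fine_measurable.
  by apply: measurable_fun_limn_esup => n; apply/measurable_EFinP.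
have normS n x : `|(S n x)%:E| <= G x.
  apply: le_trans (nneseries_lim_ge (P := xpredT) n _); last by move=> k _ _; exact: abse_ge0.
  by rewrite sumEFin lee_fin ler_norm_sum.
have cS x : G x \is a fin_num -> (S n x)%:E @[n --> \oo] --> (H x)%:E.
  move=> Gfin.
  have cvgS : cvgn (series (h ^~ x)).
    apply: (@normed_cvg R R^o); apply: nondecreasing_is_cvgn.
      by apply: nondecreasing_series => k _ _; exact: normr_ge0.
    exists (fine (G x)) => _ [n _ <-].
    rewrite -lee_fin fineK//.
    apply: le_trans (nneseries_lim_ge (P := xpredT) n _); last by move=> k _ _; exact: abse_ge0.
    by rewrite sumEFin lee_fin.
  have cS : (S n x)%:E @[n --> \oo] --> (limn (series (h ^~ x)))%:E.
    by apply: cvg_EFin => //; exact: nearW.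
  suff -> : H x = limn (series (h ^~ x)) by [].
  rewrite /H is_cvg_limn_esupE; last by apply/cvg_ex; eexists; exact: cS.
  by rewrite (cvg_lim _ cS).
have [] := @dominated_convergence _ _ _ mu I mI (fun n x => (S n x)%:E) (EFin \o H) G.
- by move=> n; apply/measurable_EFinP.
- by apply/measurable_EFinP.
- by have := integrable_ae mI iG; apply: filterS => x GI xI; apply/cS/GI.
- exact: iG.
- exact: aeW.
move=> iH cH _; exists H; split => //.
move=> x hx; rewrite /H.
have -> : (fun n => (S n x)%:E) = cst 0 by apply/funext => n; rewrite /S big1.
rewrite is_cvg_limn_esupE ?lim_cst//.
exact: cvg_cst.
Qed.

Lemma nrmC_le_ReIm (f : T -> R[i]) : measurable_funC I f ->
  nrmC mu I f <= \int[mu]_(x in I) `|(complex.Re (f x))%:E| +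
                 \int[mu]_(x in I) `|(complex.Im (f x))%:E|.
Proof.
move=> mf; case: (mf) => m1 m2; rewrite /nrmC -ge0_integralD//; first last.
- by apply: measurableT_comp => //; apply/measurable_EFinP.
- by apply: measurableT_comp => //; apply/measurable_EFinP.
apply: ge0_le_integral => //.
- by move=> x _; rewrite lee_fin normc_ge0.
- by apply/measurable_EFinP/measurable_fun_normc.
- by apply: emeasurable_funD; apply: measurableT_comp => //; apply/measurable_EFinP.
- by move=> x _; rewrite -EFinD lee_fin normc_le_ReIm.
Qed.

Lemma Re_le_nrmC (f : T -> R[i]) : measurable_funC I f ->
  \int[mu]_(x in I) `|(complex.Re (f x))%:E| <= nrmC mu I f.
Proof.
move=> mf; case: (mf) => m1 m2; apply: ge0_le_integral => //.
- by apply: measurableT_comp => //; apply/measurable_EFinP.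
- by apply/measurable_EFinP/measurable_fun_normc.
- by move=> x _; rewrite lee_fin Re_le_normc.
Qed.

Lemma Im_le_nrmC (f : T -> R[i]) : measurable_funC I f ->
  \int[mu]_(x in I) `|(complex.Im (f x))%:E| <= nrmC mu I f.
Proof.
move=> mf; case: (mf) => m1 m2; apply: ge0_le_integral => //.
- by apply: measurableT_comp => //; apply/measurable_EFinP.
- by apply/measurable_EFinP/measurable_fun_normc.
- by move=> x _; rewrite lee_fin Im_le_normc.
Qed.

Lemma ReB (u v : R[i]) : complex.Re (u - v)%R = (complex.Re u - complex.Re v)%R.
Proof. by case: u => ? ?; case: v. Qed.

Lemma ImB (u v : R[i]) : complex.Im (u - v)%R = (complex.Im u - complex.Im v)%R.
Proof. by case: u => ? ?; case: v. Qed.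

Lemma Re_sum (J : Type) (r : seq J) (F : J -> R[i]) :
  complex.Re (\sum_(j <- r) F j)%R = (\sum_(j <- r) complex.Re (F j))%R.
Proof.
elim: r => [|j r IHr]; rewrite ?big_nil// !big_cons -IHr.
by case: (F j) => ? ?; case: (bigop.body _ _ _).
Qed.

Lemma Im_sum (J : Type) (r : seq J) (F : J -> R[i]) :
  complex.Im (\sum_(j <- r) F j)%R = (\sum_(j <- r) complex.Im (F j))%R.
Proof.
elim: r => [|j r IHr]; rewrite ?big_nil// !big_cons -IHr.
by case: (F j) => ? ?; case: (bigop.body _ _ _).
Qed.

Lemma nrmC_series_cvg (h : nat -> T -> R[i]) (M : R) :
  (forall k, measurable_funC I (h k)) ->
  (forall n, \sum_(0 <= k < n) nrmC mu I (h k) <= M%:E) ->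
  exists H : T -> R[i], [/\ measurable_funC I H, nrmC mu I H < +oo,
    (forall x, (forall k, h k x = 0%R) -> H x = 0%R) &
    nrmC mu I (fun x => \sum_(0 <= k < n) h k x - H x)%R @[n --> \oo] --> 0].
Proof.
move=> mh hM.
have [||H1 [i1 z1 c1]] := @L1_series_cvg (fun k x => complex.Re (h k x)) M.
- by move=> k; have [] := mh k.
- by move=> n; apply: le_trans (hM n); apply: lee_sum => k _; exact: Re_le_nrmC.
have [||H2 [i2 z2 c2]] := @L1_series_cvg (fun k x => complex.Im (h k x)) M.
- by move=> k; have [] := mh k.
- by move=> n; apply: le_trans (hM n); apply: lee_sum => k _; exact: Im_le_nrmC.
pose H x : R[i] := H1 x +i* H2 x.
have [mH fH] : measurable_funC I H /\ nrmC mu I H < +oo.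
  by apply: (proj1 (@integrableCP _ _ _ mu _ mI H)).
exists H; split=> //.
  by move=> x hx; rewrite /H z1 ?z2// => k; rewrite hx.
apply: (@squeeze_cvge _ _ _ _ (cst 0) _ (fun n =>
  \int[mu]_(x in I) `|(\sum_(0 <= k < n) complex.Re (h k x) - H1 x)%:E| +
  \int[mu]_(x in I) `|(\sum_(0 <= k < n) complex.Im (h k x) - H2 x)%:E|)); last 2 first.
- exact: cvg_cst.
- by rewrite -[0]adde0; apply: cvgeD.
apply: nearW => n; rewrite integral_ge0/=; last by move=> x _; rewrite lee_fin normc_ge0.
have mf : measurable_funC I (fun x => \sum_(0 <= k < n) h k x - H x)%R.
  by apply: measurable_funCB => //; apply: measurable_funC_sum.
apply: (le_trans (nrmC_le_ReIm mf)).
rewrite le_eqVlt; apply/orP; left; apply/eqP; congr (_ + _);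
  by apply: eq_integral => x _; rewrite ?ReB ?ImB ?Re_sum ?Im_sum.
Qed.

Lemma integral_finite_range (p : T -> nat) (n : nat) (w : \bar R) (v : nat -> R) :
  (forall x, I x -> (p x < n)%N) ->
  (forall i, measurable (I `&` [set x | p x = i])) ->
  (forall i, (i < n)%N -> mu (I `&` [set x | p x = i]) = w) ->
  (forall i, 0 <= v i)%R ->
  \int[mu]_(x in I) (v (p x))%:E = \sum_(0 <= i < n) (v i)%:E * w.
Proof.
move=> pn mp mup v0; pose A i := I `&` [set x | p x = i].
transitivity (\int[mu]_(x in I) (\sum_(0 <= i < n) (v i)%:E * (\1_(A i) x)%:E)).
  apply: eq_integral => x; rewrite inE => xI.
  rewrite (bigD1_seq (p x)) ?mem_index_iota ?iota_uniq ?pn//=.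
  rewrite big1_seq ?adde0; last first.
    move=> i /andP[ix _]; rewrite indicE memNset ?mule0//= => -[_ /= xi].
    by rewrite xi eqxx in ix.
  by rewrite indicE mem_set ?mule1.
rewrite ge0_integral_sum//; first last.
- by move=> i x _; rewrite -EFinM lee_fin mulr_ge0.
- move=> i; apply: measurable_funeM; apply/measurable_EFinP.
  exact/measurable_funTS/measurable_indic/mp.
apply: eq_big_nat => i /andP[_ iK].
rewrite ge0_integralZl//; first last.
- by rewrite lee_fin.
- apply/measurable_EFinP; exact/measurable_funTS/measurable_indic/mp.
rewrite integral_indic//; last exact: mp.
by rewrite setIidl ?mup//; move=> x [].
Qed.

(** Turns measures into norms, so that exceptional sets can be measured by counting cells. *)
Lemma measure_nrmC (B : set T) : measurable B -> B `<=` I ->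
  mu B = nrmC mu I (fun x => (x \in B)%:R).
Proof.
move=> mB BI; rewrite -[in LHS](setIidl BI) -(integral_indic mu mI mB).
apply: eq_integral => x _; rewrite indicE.
by case: (x \in B); rewrite ?Normc.normc0 ?Normc.normc1.
Qed.

End L1_complete.

(** * Step functions on a-adic intervals *)

Section step_functions.
Variables (R : realType) (a : nat).
Hypothesis ha : (2 <= a)%N.
Local Notation mu := (@completed_lebesgue_measure R).
Local Notation I := (`[0%R, 1%R[%classic : set (lebesgueType R)).

Lemma unitP (x : R) : I x = (0 <= x < 1) :> Prop.
Proof. by rewrite /= in_itv. Qed.

Definition cell (K i : nat) : set (lebesgueType R) := [set x : R | I x /\ idx a K x = i].

Lemma idx_itv K i : [set x : R | (x \in `[0, 1[) /\ idx a K x = i] =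
  `[0, 1[ `&` `[i%:R / a%:R ^+ K, i.+1%:R / a%:R ^+ K[.
Proof.
apply/seteqP; split => x /=; rewrite !in_itv/= => -[/andP[x0 x1]].
  by move=> /eqP; rewrite idx_eq// x0 x1 => ->.
by rewrite -idx_eq// x0 x1 => /eqP.
Qed.

Lemma cellE K i : cell K i =
  I `&` (`[i%:R / a%:R ^+ K, i.+1%:R / a%:R ^+ K[%classic : set R).
Proof. exact: idx_itv. Qed.

Lemma measurable_cell K i : measurable (cell K i).
Proof.
rewrite cellE; apply: measurableI; first exact: measurable_unit.
by apply: lebesgue_measurable_Borel; exact: measurable_itv.
Qed.

Lemma measure_cell K i : (i < a ^ K)%N -> mu (cell K i) = ((a%:R ^+ K)^-1)%:E.
Proof.
move=> iK; have aK := expaR_gt0 R ha K.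
rewrite cellE setIidr; last first.
  move=> x /=; rewrite !in_itv/= => /andP[x0 x1].
  rewrite (le_trans _ x0) ?divr_ge0 ?(ltW aK)//= (lt_le_trans x1)//.
  by rewrite ler_pdivrMr// mul1r -natrX ler_nat.
rewrite completed_lebesgue_measureE lebesgue_measure_itv/= lte_fin.
rewrite ltr_pM2r ?invr_gt0// ltr_nat ltnSn -EFinB -mulrBl; congr (_%:E).
by rewrite -natrB ?subSnn ?mul1r// leqnSn.
Qed.

Lemma measurable_step d (U : measurableType d) (v : nat -> U) K :
  measurable_fun I (fun x : lebesgueType R => v (idx a K x)).
Proof.
move=> _ B mB.
rewrite [X in measurable X](_ : _ = \bigcup_(i in [set i | B (v i)]) cell K i).
  by apply: bigcup_measurable => i _; exact: measurable_cell.
apply/seteqP; split => x /=.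
  by move=> [xI Bv]; exists (idx a K x).
by move=> [i /= Bi [xI xi]]; split => //=; rewrite xi.
Qed.

Definition mfunC (f : R -> R[i]) : Prop := measurable_funC I f.

Lemma L1normE (f : R -> R[i]) : L1norm f = nrmC mu I f.
Proof. by []. Qed.

Lemma L1P (f : R -> R[i]) : L1 f <-> mfunC f /\ (L1norm f < +oo)%E.
Proof. exact: (@integrableCP _ _ _ _ _ (@measurable_unit R)). Qed.

Lemma mfunC_cst c : mfunC (fun=> c).
Proof. exact: measurable_funC_cst. Qed.

Lemma eq_mfunC (f g : R -> R[i]) : mfunC f -> (forall x : R, 0 <= x < 1 -> f x = g x) ->
  mfunC g.
Proof. by move=> mf h; apply: (eq_measurable_funC mf) => x; rewrite unitP; exact: h. Qed.

Lemma mfunCD f g : mfunC f -> mfunC g -> mfunC (fun x => f x + g x).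
Proof. exact: measurable_funCD. Qed.

Lemma mfunCB f g : mfunC f -> mfunC g -> mfunC (fun x => f x - g x).
Proof. exact: measurable_funCB. Qed.

Lemma mfunCM f g : mfunC f -> mfunC g -> mfunC (fun x => f x * g x).
Proof. exact: measurable_funCM. Qed.

Lemma mfunCZ c f : mfunC f -> mfunC (fun x => c * f x).
Proof. by move=> mf; apply: mfunCM => //; exact: mfunC_cst. Qed.

Lemma mfunC_sum (J : Type) (r : seq J) (P : pred J) (f : J -> R -> R[i]) :
  (forall j, mfunC (f j)) -> mfunC (fun x => \sum_(j <- r | P j) f j x).
Proof. exact: measurable_funC_sum. Qed.

Lemma eq_L1norm (f g : R -> R[i]) : (forall x : R, 0 <= x < 1 -> f x = g x) ->
  L1norm f = L1norm g.
Proof. by move=> h; apply: eq_nrmC => x; rewrite unitP; exact: h. Qed.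

Lemma L1norm_pos (f : R -> R[i]) : (0 <= L1norm f)%E.
Proof. exact: nrmC_ge0. Qed.

Lemma L1norm_cst0 : L1norm (fun=> 0 : R[i]) = 0%E.
Proof. exact: nrmC0. Qed.

Lemma le_L1norm (k : R) (f g : R -> R[i]) : 0 <= k -> mfunC f -> mfunC g ->
  (forall x : R, 0 <= x < 1 -> Normc.normc (f x) <= k * Normc.normc (g x)) ->
  (L1norm f <= k%:E * L1norm g)%E.
Proof.
move=> k0 mf mg h; rewrite !L1normE.
apply: (@le_nrmCZ _ _ _ mu _ (@measurable_unit R) k f g k0 mf mg) => x.
by rewrite unitP; exact: h.
Qed.

Lemma L1norm_le_cst (k : R) (f : R -> R[i]) : 0 <= k -> mfunC f ->
  (forall x : R, 0 <= x < 1 -> Normc.normc (f x) <= k) -> (L1norm f <= k%:E)%E.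
Proof.
move=> k0 mf h; rewrite !L1normE.
by apply: (@nrmC_le_cst _ _ _ mu _ (@measurable_unit R) (@measure_unit R) k f k0 mf) => x;
  rewrite unitP; exact: h.
Qed.

Lemma L1normD (f g : R -> R[i]) : mfunC f -> mfunC g ->
  (L1norm (fun x => f x + g x)%R <= L1norm f + L1norm g)%E.
Proof. by move=> mf mg; rewrite !L1normE; apply: nrmCD => //; exact: measurable_unit. Qed.

Lemma L1normB (f g : R -> R[i]) : mfunC f -> mfunC g ->
  (L1norm (fun x => f x - g x)%R <= L1norm f + L1norm g)%E.
Proof. by move=> mf mg; rewrite !L1normE; apply: nrmCB => //; exact: measurable_unit. Qed.

Lemma L1norm_sum (J : Type) (r : seq J) (P : pred J) (f : J -> R -> R[i]) :
  (forall j, mfunC (f j)) ->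
  (L1norm (fun x => \sum_(j <- r | P j) f j x)%R <= \sum_(j <- r | P j) L1norm (f j))%E.
Proof. by move=> mf; rewrite !L1normE; apply: nrmC_sum => //; exact: measurable_unit. Qed.

Lemma L1_series_limit (h : nat -> R -> R[i]) (M : R) :
  (forall k, mfunC (h k)) ->
  (forall n, \sum_(0 <= k < n) L1norm (h k) <= M%:E)%E ->
  exists H : R -> R[i], [/\ mfunC H, (L1norm H < +oo)%E,
    (forall x, (forall k, h k x = 0) -> H x = 0) &
    L1norm (fun x => \sum_(0 <= k < n) h k x - H x)%R @[n --> \oo] --> 0%E].
Proof. exact: (@nrmC_series_cvg _ _ _ mu _ (@measurable_unit R) h M). Qed.

Lemma mfunC_step (v : nat -> R[i]) K :
  mfunC (fun x => v (idx a K x)).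
Proof. by split; [exact: (measurable_step (fun i => complex.Re (v i)))|
                  exact: (measurable_step (fun i => complex.Im (v i)))]. Qed.

Lemma mfunC_walsh n : mfunC (walsh a n).
Proof.
apply: (eq_mfunC (mfunC_step (fun i => walsh a n (i%:R / a%:R ^+ n)) n)) => x.
by move=> /andP[x0 _]; rewrite -walsh_idx.
Qed.

Lemma L1norm_step (v : nat -> R[i]) K :
  L1norm (fun x => v (idx a K x)) =
  (\sum_(0 <= i < a ^ K) Normc.normc (v i) / a%:R ^+ K)%:E.
Proof.
rewrite /L1norm (@integral_finite_range _ _ _ _ _ (@measurable_unit R) (idx a K)
  (a ^ K) ((a%:R ^+ K)^-1)%:E (fun i => Normc.normc (v i))).
- by rewrite -sumEFin; apply: eq_bigr => i _; rewrite -EFinM.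
- by move=> x; rewrite unitP; exact: idx_lt.
- by move=> i; exact: measurable_cell.
- by move=> i; exact: measure_cell.
- by move=> i; exact: normc_ge0.
Qed.

Definition level_set K (q : pred nat) : set (lebesgueType R) :=
  [set x : R | I x /\ q (idx a K x)].

Lemma measurable_level_set K q : measurable (level_set K q).
Proof.
rewrite [level_set K q](_ : _ = \bigcup_(p in [set p | q p]) cell K p).
  by apply: bigcup_measurable => p _; exact: measurable_cell.
apply/seteqP; split => [x [xI Px]|x [p /= Pp [xI xp]]].
  by exists (idx a K x).
by split => //; rewrite xp.
Qed.

Lemma measure_level_set K q :
  mu (level_set K q) = L1norm (fun x => (q (idx a K x))%:R : R[i]).
Proof.
rewrite (@measure_nrmC _ _ _ mu _ (@measurable_unit R) _ (@measurable_level_set K q)).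
  rewrite -L1normE; apply: eq_L1norm => x xI; congr (_%:R); congr nat_of_bool.
  apply/idP/idP => [|qx]; first by rewrite inE => -[].
  by rewrite inE; split => //; rewrite unitP.
by move=> x [].
Qed.

End step_functions.

(* Unfolding these makes unification explore the Caratheodory measure. *)
#[local] Opaque mfunC L1norm.

Lemma normc_natr (R : realType) (n : nat) : Normc.normc (n%:R : R[i]) = n%:R.
Proof.
have -> : (n%:R : R[i]) = (n%:R : R)%:C by rewrite rmorph_nat.
by rewrite /= expr0n/= addr0 sqrtr_sqr ger0_norm.
Qed.

Lemma le_normc_sum (R : realType) (J : Type) (r : seq J) (F : J -> R[i]) :
  Normc.normc (\sum_(j <- r) F j) <= \sum_(j <- r) Normc.normc (F j).
Proof.
elim: r => [|j r IHr]; first by rewrite !big_nil Normc.normc0.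
by rewrite !big_cons (le_trans (ler_normcD _ _))// lerD2l.
Qed.

Lemma sum_divn_modn (V : nmodType) (m n : nat) (F : nat -> V) :
  \sum_(0 <= k < n) F k = \sum_(0 <= i < n %/ m) \sum_(0 <= j < m) F (i * m + j)%N
    + \sum_(0 <= j < n %% m) F (n %/ m * m + j)%N.
Proof.
rewrite -sum_mul_nat (big_cat_nat (n := (n %/ m * m)%N))//=; last exact: leq_trunc_div.
congr (_ + _); rewrite -{1}[(n %/ m * m)%N]add0n {2}(divn_eq n m) big_addn addKn.
by apply: eq_bigr => i _; rewrite addnC.
Qed.

(** * Norms of cells and of Dirichlet kernels *)

Section kernel_estimates.
Variables (R : realType) (a : nat).
Hypothesis ha : (2 <= a)%N.
Lemma L1norm_cell K i : (i < a ^ K)%N ->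
  L1norm (fun x => (idx a K x == i)%:R : R[i]) = ((a%:R ^+ K)^-1)%:E.
Proof.
move=> iK; rewrite (L1norm_step ha (fun j => (j == i)%:R) K); congr (_%:E).
rewrite (bigD1_seq i) ?mem_index_iota ?iota_uniq//= eqxx Normc.normc1 mul1r.
by rewrite big1 ?addr0// => j /negPf ->; rewrite Normc.normc0 mul0r.
Qed.

(** Count cells of level s + v: [i] prescribes the first K digits, the last v are 0, and the s - K
    digits in between are free. This leaves a^(s-K) cells of measure a^-(s+v). *)
Lemma L1norm_subcell K i s v : (i < a ^ K)%N -> (K <= s)%N ->
  L1norm (fun x => ((idx a K x == i) && (a ^ v %| idx a (s + v) x)%N)%:R : R[i]) =
  ((a%:R ^+ K)^-1 * (a%:R ^+ v)^-1)%:E.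
Proof.
move=> iK Ks.
have aE : (a ^ (s + v) = a ^ K * (a ^ (s - K) * a ^ v))%N.
  by rewrite -!expnD; congr (a ^ _)%N; lia.
rewrite (eq_L1norm (g := fun x => ((idx a (s + v) x %/ (a ^ (s - K) * a ^ v) == i)
    && (a ^ v %| idx a (s + v) x))%N%:R)); last first.
  move=> x /andP[x0 _]; rewrite (idx_divn ha K (s - K + v) x0) addnA subnKC//.
  by rewrite expnD.
rewrite (L1norm_step ha (fun p => ((p %/ (a ^ (s - K) * a ^ v) == i)
    && (a ^ v %| p))%N%:R) (s + v)); congr (_%:E).
rewrite -big_distrl/= [in \sum_(_ <= _ < a ^ _) _]aE sum_mul_nat.
rewrite (bigD1_seq i) ?mem_index_iota ?iota_uniq//=.
rewrite [X in _ + X]big1_seq ?addr0; last first.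
  move=> j /andP[ji _]; rewrite big1_seq// => q /andP[_].
  rewrite mem_index_iota => /andP[_ qlt].
  rewrite divnMDl ?muln_gt0 ?expa_gt0// divn_small// addn0 (negPf ji).
  by rewrite Normc.normc0.
rewrite sum_mul_nat.
rewrite (eq_big_nat _ _ (F2 := fun=> 1)).
  rewrite sumr_const_nat subn0 natrX.
  have -> : (a%:R ^+ (s + v) : R) = a%:R ^+ (s - K) * (a%:R ^+ K * a%:R ^+ v).
    by rewrite -!exprD; congr (_ ^+ _); lia.
  have h k : a%:R ^+ k != 0 :> R by rewrite gt_eqF// expaR_gt0.
  by field; rewrite !h.
move=> u /andP[_ ult].
rewrite big_ltn ?expa_gt0// big1_seq ?addr0.
  rewrite addn0 divnMDl ?muln_gt0 ?expa_gt0// divn_small ?ltn_pmul2r ?expa_gt0//.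
  by rewrite addn0 eqxx dvdn_add ?dvdn_mull// Normc.normc1.
move=> w /andP[_]; rewrite mem_index_iota => /andP[w0 wlt].
rewrite addnA dvdn_addr; last by rewrite dvdn_add ?dvdn_mull.
rewrite gtnNdvd// andbF.
by rewrite Normc.normc0.
Qed.

Lemma mfunC_dirichlet n (y : R) : mfunC (dirichlet a n y).
Proof.
apply: mfunC_sum => j; apply: mfunCM.
  exact: mfunC_cst.
exact: mfunC_walsh.
Qed.

Lemma L1norm_dirichletX r (y : R) : 0 <= y < 1 -> L1norm (dirichlet a (a ^ r) y) = 1%E.
Proof.
move=> yI; have y0 := proj1 (andP yI).
have id0 (x : R) : 0 <= x < 1 -> idx a 0 x = 0%N.
  by move=> /(idx_lt ha 0); rewrite expn0 ltnS leqn0 => /eqP.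
rewrite (eq_L1norm (g := fun x => (fun p => (a ^ r)%:R * (p == idx a r y)%:R) (idx a r x))).
  rewrite (L1norm_step ha (fun p => (a ^ r)%:R * (p == idx a r y)%:R) r); congr (_%:E).
  rewrite (bigD1_seq (idx a r y)) ?mem_index_iota ?iota_uniq ?idx_lt//= eqxx.
  rewrite mulr1 normc_natr natrX divff ?gt_eqF ?expaR_gt0//.
  by rewrite big1 ?addr0// => j /negPf ->; rewrite mulr0 Normc.normc0 mul0r.
by move=> x xI; rewrite dirichletX// ?id0//; case/andP: xI.
Qed.

(** Divide the frequencies below [n] into blocks of length a^r. A full block is a unimodular factor
    times the kernel of order a^r, hence of norm 1, and there are at most a^(K-r) of them; the
    remainder has fewer than a^r terms, each of modulus 1. *)
Lemma L1norm_dirichlet_le n K r (y : R) : 0 <= y < 1 -> (n <= a ^ K)%N -> (r <= K)%N ->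
  (L1norm (dirichlet a n y) <= (a%:R ^+ (K - r) + a%:R ^+ r)%:E)%E.
Proof.
move=> yI nK rK.
pose t m x : R[i] := (walsh a (m * a ^ r) y)^-1 * walsh a (m * a ^ r) x.
have mt m : mfunC (t m).
  by apply: mfunCM; [exact: mfunC_cst|exact: mfunC_walsh].
have nt m x : Normc.normc (t m x) = 1.
  by rewrite Normc.normcM Normc.normcV !normc_walsh invr1 mulr1.
have dE l m x : (l <= a ^ r)%N ->
    \sum_(0 <= j < l) (walsh a (m * a ^ r + j) y)^-1 * walsh a (m * a ^ r + j) x
    = t m x * dirichlet a l y x.
  move=> lr; rewrite /dirichlet big_distrr/=; apply: eq_big_nat => j /andP[_ jl].
  have jr := leq_trans jl lr.
  by rewrite !walshD// invfM /t; ring.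
have mtd m l : mfunC (fun x => t m x * dirichlet a l y x).
  by apply: mfunCM; [exact: mt|exact: mfunC_dirichlet].
rewrite (eq_L1norm (g := fun x => \sum_(0 <= m < n %/ a ^ r) (t m x * dirichlet a (a ^ r) y x)
   + t (n %/ a ^ r)%N x * dirichlet a (n %% a ^ r) y x)); last first.
  move=> x _; rewrite {1}/dirichlet (sum_divn_modn (a ^ r)); congr (_ + _).
    by apply: eq_bigr => m _; exact: dE.
  by apply: dE; rewrite ltnW// ltn_mod expa_gt0.
apply: (le_trans (L1normD (mfunC_sum _ _ _) (mtd _ _))); first by move=> m; exact: mtd.
rewrite EFinD; apply: leeD.
  apply: (le_trans (L1norm_sum _ _ _)); first by move=> m; exact: mtd.
  apply: (@le_trans _ _ (\sum_(0 <= m < n %/ a ^ r) 1%E)%E).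
    apply: lee_sum => m _; rewrite -(L1norm_dirichletX r yI) -[leRHS]mul1e.
    apply: le_L1norm => [|||x _]; [by []|exact: mtd|exact: mfunC_dirichlet|].
    by rewrite Normc.normcM nt.
  rewrite sumEFin lee_fin sumr_const_nat subn0 -natrX ler_nat.
  rewrite -ltnS ltn_divLR ?expa_gt0// (leq_ltn_trans nK)// mulSn -expnD subnK//.
  by rewrite -[ltnLHS]add0n ltn_add2r expa_gt0.
apply: L1norm_le_cst => [||x _]; [by rewrite ltW// expaR_gt0|exact: mtd|].
rewrite Normc.normcM nt mul1r.
apply: (le_trans (le_normc_sum _ _)).
rewrite (eq_bigr (fun=> 1)); last first.
  by move=> j _; rewrite Normc.normcM Normc.normcV !normc_walsh invr1 mulr1.
by rewrite sumr_const_nat subn0 -natrX ler_nat ltnW// ltn_mod expa_gt0.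
Qed.

End kernel_estimates.

(** * Walsh polynomials representing step functions *)

Section one_cell.
Variables (R : realType) (a : nat).
Hypothesis ha : (2 <= a)%N.
Variables (K i s v : nat) (z : R[i]).
Hypotheses (iK : (i < a ^ K)%N) (Ks : (K <= s)%N).

Let y : R := i%:R / a%:R ^+ K.

(** The indicator of the cell is a^-K times the kernel of order a^K at its left endpoint [y], and
    the peak a^v 1 is the sum over m < a^v of the characters of index m a^s. The term m = 0 cancels
    against 1, so the frequency m a^s + j with m >= 1 keeps this coefficient. Unflagged indices
    receive a value of the same modulus, to fill the gaps of a monotone sequence. *)
Definition cell_coef (n : nat) : R[i] :=
  - (z / (a ^ K)%:R) * (walsh a (n %% a ^ s) y)^-1.

Definition cell_flag (n : nat) : bool := (a ^ s <= n)%N && (n %% a ^ s < a ^ K)%N.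

Definition cell_psum (n : nat) (x : R) : R[i] :=
  \sum_(0 <= k < n) (cell_flag k)%:R * cell_coef k * walsh a k x.

(** Contribution of the frequencies m a^s + j with j < l. The factor [m != 0] and the minimum
    express [cell_flag]: nothing occurs below a^s, and j stops at a^K. *)
Let part (m l : nat) (x : R) : R[i] :=
  (m != 0)%:R * (- (z / (a ^ K)%:R) * walsh a (m * a ^ s) x)
  * dirichlet a (minn l (a ^ K)) y x.

Lemma cell_point_in01 : 0 <= y < 1.
Proof.
have aK := expaR_gt0 R ha K; apply/andP; split.
  by rewrite /y divr_ge0// ltW.
by rewrite /y ltr_pdivrMr// mul1r -natrX ltr_nat.
Qed.

Lemma normc_cell_coef n : Normc.normc (cell_coef n) = Normc.normc z / a%:R ^+ K.
Proof.
rewrite Normc.normcM normcNr Normc.normcM !Normc.normcV normc_walsh// invr1 mulr1.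
by rewrite normc_natr natrX.
Qed.

Let partE m l x : (l <= a ^ s)%N ->
  \sum_(0 <= j < l) (cell_flag (m * a ^ s + j))%:R * cell_coef (m * a ^ s + j) *
    walsh a (m * a ^ s + j) x = part m l x.
Proof.
move=> ls.
transitivity (\sum_(0 <= j < l | (j < a ^ K)%N) (m != 0)%:R *
    (- (z / (a ^ K)%:R) * walsh a (m * a ^ s) x) *
    ((walsh a j y)^-1 * walsh a j x)).
  rewrite [RHS]big_mkcond/=; apply: eq_big_nat => j /andP[_ jl].
  have js := leq_trans jl ls.
  have fE : cell_flag (m * a ^ s + j) = (m != 0) && (j < a ^ K)%N.
    rewrite /cell_flag modnMDl modn_small//; congr (_ && _).
    case: m => [|m]; first by rewrite mul0n add0n leqNgt js.
    by rewrite mulSn -addnA leq_addr.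
  rewrite fE /cell_coef modnMDl modn_small// walshD//.
  by case: ifP => jK; rewrite ?andbT ?andbF ?mul0r//; ring.
rewrite -big_distrr/=; congr (_ * _); rewrite /dirichlet.
have [lK|Kl] := leqP l (a ^ K).
  rewrite [LHS]big_mkcond/=; apply: eq_big_nat => j /andP[_ jl].
  by rewrite (leq_trans jl lK).
by rewrite (big_nat_widen _ _ _ _ _ (ltnW Kl)).
Qed.

Let psumE n x : cell_psum n x =
  \sum_(0 <= m < n %/ a ^ s) part m (a ^ s) x + part (n %/ a ^ s) (n %% a ^ s) x.
Proof.
rewrite /cell_psum (sum_divn_modn (a ^ s)); congr (_ + _).
  by apply: eq_bigr => m _; exact: partE.
by apply: partE; rewrite ltnW// ltn_mod expa_gt0.
Qed.

Let KsX : (a ^ K <= a ^ s)%N.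
Proof. by rewrite leq_exp2l. Qed.

(** All blocks 1 <= m < a^v are complete here: the kernel at [y] produces the indicator of the cell,
    and the sum over m is that of [sum_walsh_mulX] without its term m = 0. *)
Lemma cell_psum_total x : 0 <= x < 1 -> cell_psum (a ^ (s + v)) x =
  z * (idx a K x == i)%:R -
  z * (a ^ v)%:R * ((idx a K x == i) && (a ^ v %| idx a (s + v) x)%N)%:R.
Proof.
move=> /andP[x0 x1]; rewrite psumE expnD mulKn ?expa_gt0// modnMr.
have p0 m : part m 0 x = 0 by rewrite /part min0n /dirichlet big_geq// mulr0.
have p00 l : part 0 l x = 0 by rewrite /part !mul0r.
rewrite p0 addr0.
have y0 := proj1 (andP cell_point_in01).
have id0 (t : R) : 0 <= t < 1 -> idx a 0 t = 0%N.
  by move=> /(idx_lt ha 0); rewrite expn0 ltnS leqn0 => /eqP.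
have DE : dirichlet a (a ^ K) y x = (a ^ K)%:R * (idx a K x == i)%:R.
  rewrite dirichletX//; last by rewrite !id0 ?x0 ?cell_point_in01.
  by rewrite /y idx_point.
have aK0 : (a ^ K)%:R != 0 :> R[i] by rewrite pnatr_eq0 -lt0n expa_gt0.
have := @sum_walsh_mulX R a ha s v x x0.
rewrite !(big_ltn (expa_gt0 ha v)) mul0n.
have -> : walsh a 0 x = 1 by rewrite /walsh big_ord0.
move=> e.
have {}e : \sum_(1 <= m < a ^ v) walsh a (m * a ^ s) x =
    (a ^ v)%:R * (a ^ v %| idx a (s + v) x)%N%:R - 1.
  by rewrite -e addrAC subrr add0r.
rewrite p00 add0r.
rewrite (eq_big_nat _ _ (F2 := fun m => (- (z / (a ^ K)%:R) * dirichlet a (a ^ K) y x) *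
    walsh a (m * a ^ s) x)); last first.
  move=> m /andP[m0 _]; rewrite /part -lt0n m0 mul1r (minn_idPr KsX).
  by rewrite mulrAC.
rewrite -big_distrr/= e DE -mulnb natrM.
move: ((a ^ K)%:R : R[i]) aK0 (_ == i)%:R (_ %| _)%:R (a ^ v)%:R => A A0 b1 b2 A'.
by field.
Qed.

Let mpart m l : mfunC (part m l).
Proof.
apply: mfunCM; last exact: mfunC_dirichlet.
by do 2!apply: mfunCZ; exact: mfunC_walsh.
Qed.

Let normc_part_coef m x :
  Normc.normc ((m != 0)%:R * (- (z / (a ^ K)%:R) * walsh a (m * a ^ s) x)) <=
  Normc.normc z / a%:R ^+ K.
Proof.
rewrite !Normc.normcM normcNr Normc.normcM Normc.normcV !normc_natr normc_walsh//.
rewrite natrX mulr1; case: (m != 0); rewrite ?mul1r ?mul0r//.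
by rewrite divr_ge0 ?normc_ge0// ltW// expaR_gt0.
Qed.

Let zK0 : 0 <= Normc.normc z / a%:R ^+ K.
Proof. by rewrite divr_ge0 ?normc_ge0// ltW// expaR_gt0. Qed.

Let L1norm_part m l (b : R) : (L1norm (dirichlet a (minn l (a ^ K)) y) <= b%:E)%E ->
  (L1norm (part m l) <= (Normc.normc z / a%:R ^+ K * b)%:E)%E.
Proof.
move=> hb; apply: (@le_trans _ _ ((Normc.normc z / a%:R ^+ K)%:E *
    L1norm (dirichlet a (minn l (a ^ K)) y))%E); last first.
  by rewrite (EFinM _ b); apply: lee_wpmul2l; [rewrite lee_fin; exact: zK0|exact: hb].
apply: le_L1norm => [|||x _]; [exact: zK0|exact: mpart|exact: mfunC_dirichlet|].
by rewrite Normc.normcM ler_wpM2r ?normc_ge0 ?normc_part_coef.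
Qed.

(** At most a^v complete blocks, each of norm at most |z| a^-K, are followed by one truncated
    kernel; the parameter [r] comes from the estimate of the latter. *)
Lemma L1norm_cell_psum_le n r : (n <= a ^ (s + v))%N -> (r <= K)%N ->
  (L1norm (cell_psum n) <=
   (Normc.normc z / a%:R ^+ K * (a%:R ^+ v + (a%:R ^+ (K - r) + a%:R ^+ r)))%:E)%E.
Proof.
move=> ns rK.
rewrite (eq_L1norm (g := fun x => \sum_(0 <= m < n %/ a ^ s) part m (a ^ s) x +
  part (n %/ a ^ s) (n %% a ^ s) x)); last by move=> x _; exact: psumE.
apply: (le_trans (L1normD (mfunC_sum _ _ _) (mpart _ _))); first exact: (mpart ^~ _).
rewrite mulrDr EFinD; apply: leeD.
  apply: (le_trans (L1norm_sum _ _ _)); first by move=> m; exact: mpart.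
  apply: (@le_trans _ _ (\sum_(0 <= m < n %/ a ^ s) (Normc.normc z / a%:R ^+ K)%:E)%E).
    apply: lee_sum => m _; rewrite -[in leRHS](mulr1 (_ / _)); apply: L1norm_part.
    by rewrite (minn_idPr KsX) L1norm_dirichletX// cell_point_in01.
  rewrite sumEFin lee_fin sumr_const_nat subn0 -[_ *+ (n %/ _)]mulr_natr ler_wpM2l//.
  rewrite -natrX ler_nat -(@leq_pmul2r (a ^ s)) ?expa_gt0//.
  by rewrite (leq_trans (leq_trunc_div _ _))// -expnD addnC.
apply: L1norm_part; apply: L1norm_dirichlet_le => //.
  exact: cell_point_in01.
by rewrite geq_minr.
Qed.

(** The subtracted peak has height |z| a^v on a set of measure a^-K a^-v, so its norm is again |z|
    a^-K: this is the origin of the factor 2. *)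
Lemma L1norm_cell_psum_total :
  (L1norm (cell_psum (a ^ (s + v))) <= (2 * (Normc.normc z / a%:R ^+ K))%:E)%E.
Proof.
pose f1 (x : R) : R[i] := (idx a K x == i)%:R.
pose f2 (x : R) : R[i] := ((idx a K x == i) && (a ^ v %| idx a (s + v) x)%N)%:R.
have m1 : mfunC f1 by exact: (mfunC_step ha (fun p => (p == i)%:R)).
have m2 : mfunC f2.
  have Ksv : (s + v = K + (s + v - K))%N by rewrite subnKC// (leq_trans Ks)// leq_addr.
  apply: (eq_mfunC (mfunC_step ha (fun p => ((p %/ a ^ (s + v - K) == i)
    && (a ^ v %| p))%N%:R) (s + v))) => x /andP[x0 _].
  by rewrite /f2 (idx_divn ha K (s + v - K) x0) -Ksv.
rewrite (eq_L1norm (g := fun x => z * f1 x - z * (a ^ v)%:R * f2 x)); last first.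
  by move=> x xI; rewrite cell_psum_total.
apply: (le_trans (L1normB (mfunCZ _ m1) (mfunCZ _ m2))).
rewrite mulr_natl mulr2n EFinD; apply: leeD.
  rewrite EFinM -(L1norm_cell R ha iK); apply: le_L1norm => [|||x _].
  - exact: normc_ge0.
  - exact: mfunCZ.
  - exact: m1.
  - by rewrite Normc.normcM.
apply: (@le_trans _ _ ((Normc.normc z * a%:R ^+ v)%:E * L1norm f2)%E).
  apply: le_L1norm => [|||x _].
  - by rewrite mulr_ge0 ?normc_ge0// ltW// expaR_gt0.
  - exact: mfunCZ.
  - exact: m2.
  - by rewrite !Normc.normcM normc_natr natrX.
rewrite L1norm_subcell// -EFinM lee_fin le_eqVlt; apply/orP; left; apply/eqP.
have h k : a%:R ^+ k != 0 :> R by rewrite gt_eqF// expaR_gt0.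
by field; rewrite !h.
Qed.

Lemma cell_bad_set : exists B : set (lebesgueType R),
  [/\ measurable B,
      (completed_lebesgue_measure B <= ((a%:R ^+ K)^-1 * (a%:R ^+ v)^-1)%:E)%E &
      forall x : R, 0 <= x < 1 -> ~ B x ->
        cell_psum (a ^ (s + v)) x = z * (idx a K x == i)%:R].
Proof.
pose N := (s + v)%N.
have NE : (N = K + (N - K))%N by rewrite subnKC// (leq_trans Ks)// leq_addr.
pose P p := ((p %/ a ^ (N - K) == i) && (a ^ v %| p))%N.
have PE (x : R) : 0 <= x ->
    P (idx a N x) = (idx a K x == i) && (a ^ v %| idx a N x)%N.
  by move=> x0; rewrite /P (idx_divn ha K (N - K) x0) -NE.
exists (level_set a N P); split; first exact: measurable_level_set.
- rewrite -(@L1norm_subcell R a ha K i s v iK Ks) measure_level_set//.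
  rewrite le_eqVlt; apply/orP; left; apply/eqP; apply: eq_L1norm => x /andP[x0 _].
  by rewrite PE.
- move=> x xI nB; rewrite cell_psum_total//.
  have /negPf -> : ~~ ((idx a K x == i) && (a ^ v %| idx a (s + v) x)%N).
    apply/negP => h; apply: nB; split; first by rewrite unitP.
    by rewrite PE//; case/andP: xI.
  by rewrite mulr0 subr0.
Qed.

End one_cell.

(** * Concatenation of one-cell polynomials *)

Section blocks.
Variables (R : realType) (a : nat).
Hypothesis ha : (2 <= a)%N.
Local Notation mu := (@completed_lebesgue_measure R).

(** Convertible to [walsh_psum] when [m] is 1 and the upper bound is shifted by one, and to
    [cell_psum] when [m] is 0. *)
Definition walsh_sum (d : nat -> bool) (c : nat -> R[i]) (m n : nat) (x : R) : R[i] :=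
  \sum_(m <= k < n) (d k)%:R * c k * walsh a k x.

Lemma mfunC_walsh_sum d c m n : mfunC (walsh_sum d c m n).
Proof. by apply: mfunC_sum => k; apply: mfunCZ; exact: mfunC_walsh. Qed.

Lemma walsh_sum_cat d c p m n x : (m <= p <= n)%N ->
  walsh_sum d c m n x = walsh_sum d c m p x + walsh_sum d c p n x.
Proof. by move=> /andP[mp pn]; rewrite /walsh_sum (big_cat_nat mp pn). Qed.

Lemma eq_walsh_sum d c d' c' m n x :
  (forall k, (m <= k < n)%N -> d k = d' k /\ c k = c' k) ->
  walsh_sum d c m n x = walsh_sum d' c' m n x.
Proof.
by move=> h; apply: eq_big_nat => k /h[-> ->].
Qed.

Lemma cell_block (K i v r N0 : nat) (z : R[i]) : (i < a ^ K)%N -> (r <= K)%N ->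
  exists (N1 : nat) (c : nat -> R[i]) (d : nat -> bool) (B : set (lebesgueType R)),
  [/\ (N0 <= N1)%N, (forall n, Normc.normc (c n) = Normc.normc z / a%:R ^+ K),
      (measurable B /\ (mu B <= ((a%:R ^+ K)^-1 * (a%:R ^+ v)^-1)%:E)%E) /\
      (forall x : R, 0 <= x < 1 -> ~ B x ->
         walsh_sum d c N0 N1 x = z * (idx a K x == i)%:R),
      (L1norm (walsh_sum d c N0 N1) <= (2 * (Normc.normc z / a%:R ^+ K))%:E)%E &
      forall n, (N0 <= n <= N1)%N -> (L1norm (walsh_sum d c N0 n) <=
   (Normc.normc z / a%:R ^+ K * (a%:R ^+ v + (a%:R ^+ (K - r) + a%:R ^+ r)))%:E)%E].
Proof.
(* Then a^s is at least [N0], so no flagged frequency lies below [N0] and the sum may start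
   there. *)
move=> iK rK; pose s := maxn K N0.
have Ks : (K <= s)%N by rewrite leq_maxl.
have Ns : (N0 <= a ^ s)%N.
  by rewrite (leq_trans (leq_maxr K N0))// ltnW// ltn_expl.
have NN : (N0 <= a ^ (s + v))%N by rewrite (leq_trans Ns)// leq_pexp2l ?leq_addr// ltnW.
have sE n x : (N0 <= n)%N ->
    walsh_sum (cell_flag a K s) (cell_coef a K i s z) N0 n x = cell_psum a K i s z n x.
  move=> Nn; rewrite /cell_psum (big_cat_nat (leq0n N0) Nn)/= big1_seq ?add0r//.
  move=> k /andP[_]; rewrite mem_index_iota => /andP[_ kN].
  by rewrite /cell_flag leqNgt (leq_trans kN Ns) !mul0r.
have [B [mB muB hB]] := cell_bad_set ha v z iK Ks.
exists (a ^ (s + v))%N, (cell_coef a K i s z), (cell_flag a K s), B; split.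
- by [].
- by move=> n; exact: normc_cell_coef.
- by split=> // x xI nB; rewrite sE// hB.
- rewrite (eq_L1norm (g := cell_psum a K i s z (a ^ (s + v)))); last by move=> x _; exact: sE.
  exact: L1norm_cell_psum_total.
- move=> n /andP[Nn nN].
  rewrite (eq_L1norm (g := cell_psum a K i s z n)); last by move=> x _; exact: sE.
  exact: L1norm_cell_psum_le.
Qed.

(** Induction on the list, the modulus of the coefficients of the head being the cap [beta] for the
    tail: sorting makes this cap admissible and [w i != 0] keeps it positive. In a partial sum the
    finished cells are charged with their total norm and only the current one with the estimate for
    incomplete sums, so the term in [M] occurs once. *)
Lemma cells_block (K v r : nat) (w : nat -> R[i]) (M : R) (L : seq nat) :
  (r <= K)%N -> 0 <= M ->
  (forall i, i \in L -> [/\ (i < a ^ K)%N, w i != 0 & Normc.normc (w i) <= M]) ->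
  sorted (fun i j => Normc.normc (w j) <= Normc.normc (w i)) L ->
  forall (N0 : nat) (beta : R), 0 < beta ->
  (forall i, i \in L -> Normc.normc (w i) / a%:R ^+ K <= beta) ->
  exists (N1 : nat) (c : nat -> R[i]) (d : nat -> bool) (B : set (lebesgueType R)),
  [/\ (N0 < N1)%N,
      (forall n, (N0 <= n < N1)%N -> 0 < Normc.normc (c n) <= beta) /\
      (forall n, (N0 <= n)%N -> (n.+1 < N1)%N -> Normc.normc (c n.+1) <= Normc.normc (c n)),
      measurable B /\ (mu B <= ((size L)%:R * ((a%:R ^+ K)^-1 * (a%:R ^+ v)^-1))%:E)%E,
      (forall x : R, 0 <= x < 1 -> ~ B x ->
         walsh_sum d c N0 N1 x = \sum_(i <- L) w i * (idx a K x == i)%:R) &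
      forall n, (N0 <= n <= N1)%N -> (L1norm (walsh_sum d c N0 n) <=
        (\sum_(i <- L) 2 * (Normc.normc (w i) / a%:R ^+ K) +
         M / a%:R ^+ K * (a%:R ^+ v + (a%:R ^+ (K - r) + a%:R ^+ r)))%:E)%E].
Proof.
move=> rK M0.
have aX0 k : 0 <= a%:R ^+ k :> R by rewrite ltW// expaR_gt0.
set D : R := _ + (_ + _).
have D0 : 0 <= D by rewrite !addr_ge0.
elim: L => [|i L IHL] hL sL N0 beta b0 hb.
  (* An empty list still consumes one unflagged index, with coefficient [beta]: blocks are then
     nonempty and end with a positive modulus, even for the zero step function. *)
  exists N0.+1, (fun=> beta%:C), (fun=> false), set0.
  have bE : Normc.normc beta%:C = beta.
    by rewrite /= expr0n/= addr0 sqrtr_sqr gtr0_norm.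
  have s0 n x : walsh_sum (fun=> false) (fun=> beta%:C) N0 n x = 0.
    by rewrite /walsh_sum big1// => k _; rewrite !mul0r.
  split=> //.
  - by split=> n _; rewrite bE ?lexx ?b0.
  - by rewrite measure0 mul0r.
  - by move=> x _ _; rewrite s0 big_nil.
  - move=> n _; rewrite (eq_L1norm (g := fun=> 0)); last by move=> x _; exact: s0.
    by rewrite L1norm_cst0 big_nil add0r lee_fin mulr_ge0// divr_ge0.
have [iK wi0 wiM] := hL i (mem_head _ _).
have [N' [c0 [d0 [B0 [NN' nc0 [[mB0 muB0] hB0] T0 P0]]]]] := cell_block v N0 (w i) iK rK.
pose beta' := Normc.normc (w i) / a%:R ^+ K.
have wpos : 0 < Normc.normc (w i).
  rewrite lt_neqAle normc_ge0 andbT eq_sym; apply: contra wi0 => /eqP h.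
  by rewrite (Normc.eq0_normc h).
have b'0 : 0 < beta' by rewrite divr_gt0// expaR_gt0.
have hL' j : j \in L -> [/\ (j < a ^ K)%N, w j != 0 & Normc.normc (w j) <= M].
  by move=> jL; apply: hL; rewrite inE jL orbT.
have letr : transitive (fun i j => Normc.normc (w j) <= Normc.normc (w i)).
  by move=> ? ? ? h1 h2; exact: le_trans h2 h1.
have hb' j : j \in L -> Normc.normc (w j) / a%:R ^+ K <= beta'.
  move=> jL; rewrite ler_wpM2r ?invr_ge0//.
  by move: sL; rewrite /= (path_sortedE letr) => /andP[/allP/(_ _ jL)].
have [N1 [c1 [d1 [B1 [N'N1 [nc1 dc1] [mB1 muB1] hB1 P1]]]]] :=
  IHL hL' (path_sorted sL) N' beta' b'0 hb'.
pose c n := if (n < N')%N then c0 n else c1 n.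
pose d n := if (n < N')%N then d0 n else d1 n.
have s0 n x : (n <= N')%N -> walsh_sum d c N0 n x = walsh_sum d0 c0 N0 n x.
  move=> nN; apply: eq_walsh_sum => k /andP[_ kn].
  by rewrite /d /c (leq_trans kn nN).
have s1 n x : walsh_sum d c N' n x = walsh_sum d1 c1 N' n x.
  apply: eq_walsh_sum => k /andP[Nk _].
  by rewrite /d /c ltnNge Nk.
exists N1, c, d, (B0 `|` B1); split.
- exact: leq_ltn_trans N'N1.
- split=> n.
    move=> /andP[Nn nN1]; rewrite /c; case: ltnP => nN'.
      by rewrite nc0 b'0 hb// mem_head.
    have /nc1/andP[-> h] : (N' <= n < N1)%N by rewrite nN' nN1.
    by rewrite (le_trans h)// hb// mem_head.
  move=> Nn nN1; rewrite /c; have [nN'|nN'|nN'] := ltngtP n.+1 N'.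
  - by rewrite !nc0.
  - by apply: dc1.
  - rewrite nc0 nN'.
    by have /nc1/andP[_] : (N' <= N' < N1)%N by rewrite leqnn.
- split; first exact: measurableU.
  rewrite /= -natr1 mulrDl mul1r addrC EFinD.
  apply: (le_trans (measureU2 mu mB0 mB1)); exact: leeD.
- move=> x xI nB; rewrite (walsh_sum_cat _ _ (p := N')); last by rewrite NN' ltnW.
  rewrite s0// s1 hB0//; last by move=> ?; apply: nB; left.
  rewrite hB1//; last by move=> ?; apply: nB; right.
  by rewrite big_cons.
- move=> n /andP[Nn nN1]; rewrite big_cons.
  have S0 : 0 <= \sum_(j <- L) 2 * (Normc.normc (w j) / a%:R ^+ K) :> R.
    by apply: sumr_ge0 => j _; rewrite mulr_ge0// divr_ge0// normc_ge0.
  have [nN'|N'n] := leqP n N'.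
    rewrite (eq_L1norm (g := walsh_sum d0 c0 N0 n)); last by move=> x _; exact: s0.
    apply: (le_trans (P0 n _)); rewrite ?Nn// lee_fin.
    rewrite -[leLHS]add0r lerD// ?addr_ge0//.
      by rewrite mulr_ge0// divr_ge0// normc_ge0.
    by rewrite ler_wpM2r// ler_wpM2r// invr_ge0.
  rewrite (eq_L1norm (g := fun x => walsh_sum d0 c0 N0 N' x + walsh_sum d1 c1 N' n x)).
    apply: (le_trans (L1normD (mfunC_walsh_sum _ _ _ _) (mfunC_walsh_sum _ _ _ _))).
    have {}P1 := P1 n; rewrite (ltnW N'n) nN1 in P1.
    by apply: (le_trans (leeD T0 (P1 isT))); rewrite -EFinD lee_fin addrA.
  move=> x _; rewrite (walsh_sum_cat _ _ (p := N')); last by rewrite NN' ltnW.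
  by rewrite s0// s1.
Qed.

Lemma exists_expn_ge (C e : R) : 0 <= C -> 0 < e -> forall m : nat,
  exists2 n, (m <= n)%N & C / a%:R ^+ n <= e.
Proof.
move=> C0 e0 m; pose n := maxn m (Num.truncn (C / e)).+1.
exists n; first exact: leq_maxl.
rewrite ler_pdivrMr ?expaR_gt0// mulrC -ler_pdivrMr//.
apply: (le_trans (ltW (truncnS_gt _))); rewrite -natrX ler_nat.
by rewrite (leq_trans (leq_maxr m _))// ltnW// ltn_expl.
Qed.

Lemma step_block (K0 : nat) (w0 : nat -> R[i]) (N0 : nat) (beta eta : R) :
  0 < beta -> 0 < eta ->
  exists (N1 : nat) (c : nat -> R[i]) (d : nat -> bool) (B : set (lebesgueType R)),
  [/\ (N0 < N1)%N,
      (forall n, (N0 <= n < N1)%N -> 0 < Normc.normc (c n) <= beta) /\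
      (forall n, (N0 <= n)%N -> (n.+1 < N1)%N -> Normc.normc (c n.+1) <= Normc.normc (c n)),
      measurable B /\ (mu B <= eta%:E)%E,
      (forall x : R, 0 <= x < 1 -> ~ B x ->
         walsh_sum d c N0 N1 x = w0 (idx a K0 x)) &
      forall n, (N0 <= n <= N1)%N -> (L1norm (walsh_sum d c N0 n) <=
        2%:E * L1norm (fun x => w0 (idx a K0 x)) + eta%:E)%E].
Proof.
move=> b0 e0.
(* [M] bounds every value of the step function. The choice of [v] bounds the exceptional set, since
   at most a^K cells each lose measure a^-K a^-v. *)
pose M : R := \sum_(0 <= p < a ^ K0) Normc.normc (w0 p).
have M0 : 0 <= M by apply: sumr_ge0 => p _; exact: normc_ge0.
have [v _ hv] := exists_expn_ge ler01 e0 0.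
have aX0 k : 0 < a%:R ^+ k :> R by rewrite expaR_gt0.
(* With K = 2 r, the cost M a^-K (a^v + 2 a^r) of the incomplete cell is at most C a^-r, which also
   dominates the coefficients, of modulus at most M a^-K. Asking K0 <= r lets the step function be
   refined to level K. *)
pose C := M * (a%:R ^+ v + 2).
have C0 : 0 <= C by rewrite mulr_ge0// addr_ge0// ltW.
have m0 : 0 < Num.min beta eta by rewrite lt_min b0 e0.
have [r K0r hr] := exists_expn_ge C0 m0 K0.
pose K := (r + r)%N.
have rK : (r <= K)%N by rewrite leq_addr.
have K0K : (K0 <= K)%N by rewrite (leq_trans K0r).
pose w i := w0 (i %/ a ^ (K - K0))%N.
have wE (x : R) : 0 <= x -> w0 (idx a K0 x) = w (idx a K x).
  by move=> x0; rewrite /w (idx_divn ha K0 (K - K0) x0) subnKC.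
have wM i : (i < a ^ K)%N -> Normc.normc (w i) <= M.
  move=> iK; rewrite /M (bigD1_seq (i %/ a ^ (K - K0))%N) ?iota_uniq//=; last first.
    by rewrite mem_index_iota/= ltn_divLR ?expa_gt0// -expnD subnKC.
  by rewrite lerDl sumr_ge0// => p _; exact: normc_ge0.
pose rl := fun i j => Normc.normc (w j) <= Normc.normc (w i).
pose L0 := [seq i <- index_iota 0 (a ^ K) | w i != 0].
pose L := sort rl L0.
have LP i : i \in L -> [/\ (i < a ^ K)%N, w i != 0 & Normc.normc (w i) <= M].
  rewrite mem_sort mem_filter mem_index_iota => /andP[wi /andP[_ iK]].
  by split=> //; exact: wM.
have sL : sorted rl L by apply: sort_sorted => i j; exact: le_total.
have a1 r' : 1 <= a%:R ^+ r' :> R by rewrite -natrX (ler_nat _ 1) expa_gt0.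
have hr' : forall b, 0 <= b -> b <= a%:R ^+ r * (a%:R ^+ v + 2) ->
    M / a%:R ^+ K * b <= Num.min beta eta.
  move=> b b_ge0 hbb; apply: le_trans hr.
  rewrite /C /K exprD invfM mulrA.
  have -> : M * (a%:R ^+ v + 2) / a%:R ^+ r =
     M / a%:R ^+ r / a%:R ^+ r * (a%:R ^+ r * (a%:R ^+ v + 2)) :> R.
    by field; rewrite gt_eqF.
  by rewrite ler_wpM2l// !divr_ge0// ltW.
have hb i : i \in L -> Normc.normc (w i) / a%:R ^+ K <= beta.
  move=> /LP[_ _ wi]; apply: (@le_trans _ _ (M / a%:R ^+ K * 1)).
    by rewrite mulr1 ler_wpM2r// invr_ge0 ltW.
  apply: le_trans (hr' 1 _ _) _ => //; last by rewrite ge_min lexx.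
  rewrite -[leLHS]mulr1 ler_pM//.
  by rewrite -[leLHS]addr0 lerD.
have [N1 [c [d [B [h1 h2 [mB muB] h4 h5]]]]] := cells_block v rK M0 LP sL N0 b0 hb.
exists N1, c, d, B; split=> //.
- split=> //; apply: (le_trans muB); rewrite lee_fin.
  apply: le_trans hv; rewrite mulrA ler_wpM2r ?invr_ge0 ?(ltW (aX0 _))//.
  rewrite ler_pdivrMr// mul1r -natrX ler_nat size_sort size_filter.
  by rewrite (leq_trans (count_size _ _))// size_iota subn0.
- move=> x xI nB; rewrite h4// wE; last by case/andP: xI.
  rewrite (perm_big _ (permEl (perm_sort rl L0)))/= big_filter big_mkcond/=.
  rewrite (bigD1_seq (idx a K x)) ?mem_index_iota ?iota_uniq ?idx_lt//= eqxx mulr1.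
  rewrite big1 ?addr0.
    by case: eqVneq.
  by move=> i /negPf ix; rewrite [_ == i]eq_sym ix mulr0 if_same.
- move=> n nN; apply: (le_trans (h5 n nN)).
  rewrite (eq_L1norm (g := fun x => w (idx a K x))); last by move=> x /andP[x0 _]; exact: wE.
  rewrite (L1norm_step ha w K) -EFinM -EFinD lee_fin lerD//.
    rewrite -big_distrr/= ler_wpM2l//.
    rewrite (perm_big _ (permEl (perm_sort rl L0)))/= big_filter [leLHS]big_mkcond/=.
    apply: ler_sum => i _; case: ifP => // _.
    by rewrite divr_ge0 ?normc_ge0// ltW.
  apply: le_trans (hr' _ _ _) _; last by rewrite ge_min lexx orbT.
    by rewrite !addr_ge0// ltW.
  rewrite /K addnK mulrDr mulr_natr mulr2n lerD//.
  by rewrite -[leLHS]mul1r ler_wpM2r// ltW.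
Qed.

End blocks.

Lemma ge0_cvge0P (R : realType) (u : nat -> \bar R) : (forall n, 0 <= u n)%E ->
  u n @[n --> \oo] --> 0%E <->
  forall e : R, 0 < e -> exists N, forall n, (N <= n)%N -> (u n <= e%:E)%E.
Proof.
move=> u0; split=> [cu e e0|h].
  have /cu[N _ hN] : nbhs (0%E : \bar R) (fun x => x < e%:E)%E.
    by apply: open_ereal_lt'; rewrite lte_fin.
  by exists N => n Nn; exact/ltW/hN.
apply/fine_cvgP; split.
  have [N hN] := h 1 ltr01; exists N => // n Nn /=.
  by rewrite ge0_fin_numE// (le_lt_trans (hN n Nn))// ltry.
apply/cvgrPdist_le => e e0; have [N hN] := h e e0; exists N => // n Nn /=.
have un : u n \is a fin_num by rewrite ge0_fin_numE// (le_lt_trans (hN n Nn))// ltry.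
rewrite sub0r normrN ger0_norm ?fine_ge0// -lee_fin fineK//; exact: hN.
Qed.

(** * Density of step functions *)

Section density.
Variables (R : realType) (a : nat).
Hypothesis ha : (2 <= a)%N.
Local Notation mu := (@completed_lebesgue_measure R).

Definition step_approximable (h : R -> R[i]) : Prop :=
  forall e : R, 0 < e -> exists (K : nat) (v : nat -> R[i]),
    (L1norm (fun x => h x - v (idx a K x))%R <= e%:E)%E.

Lemma step_refine (v : nat -> R[i]) K K' (x : R) : (K <= K')%N -> 0 <= x ->
  v (idx a K x) = v (idx a K' x %/ a ^ (K' - K))%N.
Proof. by move=> KK x0; rewrite (idx_divn ha K (K' - K) x0) subnKC. Qed.

Lemma step_approximableD h1 h2 : mfunC h1 -> mfunC h2 ->
  step_approximable h1 -> step_approximable h2 ->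
  step_approximable (fun x => h1 x + h2 x).
Proof.
move=> m1 m2 a1 a2 e e0; have e20 : 0 < e / 2 by rewrite divr_gt0.
have [K1 [v1 h1v]] := a1 _ e20; have [K2 [v2 h2v]] := a2 _ e20.
pose K := maxn K1 K2.
exists K, (fun p => v1 (p %/ a ^ (K - K1))%N + v2 (p %/ a ^ (K - K2))%N).
have mv i (v : nat -> R[i]) : mfunC (fun x => v (idx a i x)) by exact: mfunC_step.
rewrite (eq_L1norm (g := fun x => (h1 x - v1 (idx a K1 x)) + (h2 x - v2 (idx a K2 x)))).
  apply: (le_trans (L1normD (mfunCB m1 (mv _ _)) (mfunCB m2 (mv _ _)))).
  by rewrite (splitr e) EFinD; exact: leeD.
move=> x /andP[x0 _].
rewrite (step_refine v1 (leq_maxl K1 K2) x0) (step_refine v2 (leq_maxr K1 K2) x0) /K.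
by rewrite opprD addrACA.
Qed.

Lemma step_approximableZ c h : mfunC h -> step_approximable h ->
  step_approximable (fun x => c * h x).
Proof.
move=> mh ah e e0.
have c0 : 0 < Normc.normc c + 1 by rewrite ltr_wpDl// normc_ge0.
have [K [v hv]] := ah (e / (Normc.normc c + 1)) (divr_gt0 e0 c0).
exists K, (fun p => c * v p).
have md : mfunC (fun x => h x - v (idx a K x)) by apply: mfunCB; [exact: mh|exact: mfunC_step].
rewrite (eq_L1norm (g := fun x => c * (h x - v (idx a K x)))); last first.
  by move=> x _; rewrite mulrBr.
have h1 : (L1norm (fun x => c * (h x - v (idx a K x)))%R <=
    (Normc.normc c)%:E * L1norm (fun x => h x - v (idx a K x))%R)%E.
  apply: le_L1norm => [|||x _]; [exact: normc_ge0|exact: mfunCZ|exact: md|].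
  by rewrite Normc.normcM.
apply: (le_trans h1).
apply: (le_trans (lee_wpmul2l _ hv)); first by rewrite lee_fin normc_ge0.
rewrite -EFinM lee_fin mulrCA ger_pMr// ler_pdivrMr// mul1r.
by rewrite lerDl.
Qed.

Lemma step_approximable_lim h : mfunC h ->
  (forall e : R, 0 < e -> exists h', [/\ mfunC h', step_approximable h' &
     (L1norm (fun x => h x - h' x)%R <= e%:E)%E]) ->
  step_approximable h.
Proof.
move=> mh H e e0; have e20 : 0 < e / 2 by rewrite divr_gt0.
have [h' [mh' ah' hh']] := H _ e20; have [K [v hv]] := ah' _ e20.
exists K, v.
have mv : mfunC (fun x => v (idx a K x)) by exact: mfunC_step.
rewrite (eq_L1norm (g := fun x => (h x - h' x) + (h' x - v (idx a K x)))).
  apply: (le_trans (L1normD (mfunCB mh mh') (mfunCB mh' mv))).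
  by rewrite (splitr e) EFinD; exact: leeD.
by move=> x _; rewrite addrA subrK.
Qed.

Lemma mfunC_real (h : R -> R) :
  measurable_fun (`[0, 1[%classic : set (lebesgueType R)) (h : lebesgueType R -> R) ->
  mfunC (fun x => (h x)%:C).
Proof. by move=> mh; split => //=; exact: measurable_cst. Qed.

Lemma mfunC_indic (A : set (lebesgueType R)) : measurable A ->
  mfunC (fun x => (x \in A)%:R).
Proof.
move=> mA; apply: (eq_mfunC (f := fun x => (\1_A x : R)%:C)).
  by apply: mfunC_real; exact/measurable_funTS/measurable_indic.
by move=> x _; rewrite indicE rmorph_nat.
Qed.

Lemma measure_L1norm (A : set (lebesgueType R)) : measurable A ->
  A `<=` (`[0, 1[%classic : set R) -> mu A = L1norm (fun x => (x \in A)%:R : R[i]).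
Proof. exact: (@measure_nrmC _ _ _ mu _ (@measurable_unit R)). Qed.

(** The cells of level K contained in [U] exhaust it as K grows, because its points are interior and
    the cells shrink. The uncovered parts [F K] decrease to the empty set, and continuity from above
    applies. *)
Lemma open_level_set_approx (U : set R) (e : R) : open U -> 0 < e ->
  exists K q, (mu ((U `&` `[0%R, 1%R[) `\` level_set a K q) <= e%:E)%E /\
    level_set a K q `<=` U.
Proof.
move=> oU e0; pose J : set (lebesgueType R) := `[0%R, 1%R[%classic.
pose q K p := `[< [set` `[p%:R / a%:R ^+ K : R, p.+1%:R / a%:R ^+ K[] `<=` U >].
have qP K (x : R) : 0 <= x < 1 -> q K (idx a K x) -> U x.
  move=> /andP[x0 _] /asboolP; apply; rewrite /= in_itv/=.
  by rewrite -(idx_eq ha)// eqxx.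
pose F K : set (lebesgueType R) := (U `&` J) `\` level_set a K (q K).
have mUI : measurable ((U `&` J) : set (lebesgueType R)).
  apply: measurableI; last exact: measurable_unit.
  by apply: lebesgue_measurable_Borel; exact: open_measurable.
have mF K : measurable (F K) by apply: measurableD => //; exact: measurable_level_set.
have F0 : \bigcap_K F K = set0.
  apply/seteqP; split => // x hx.
  have [[Ux xI] _] := hx 0%N I.
  have x01 : 0 <= x < 1 by move: xI; rewrite /J unitP.
  have x0 := proj1 (andP x01).
  have /nbhs_ballP[r /= r0 rU] : nbhs (x : R) U by exact: open_nbhs_nbhs.
  have [K _ hK] := exists_expn_ge ha ler01 (divr_gt0 r0 (ltr0n R 2)) 0.
  have [_ []] := hx K I; split; first exact: xI.
  apply/asboolP => t; rewrite /= in_itv/= => /andP[t1 t2]; apply: rU.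
  have := idx_eq ha K (idx a K x) x0; rewrite eqxx => /esym/andP[x1 x2].
  rewrite /ball/= ltr_norml.
  have d : (idx a K x).+1%:R / a%:R ^+ K = (idx a K x)%:R / a%:R ^+ K + 1 / a%:R ^+ K :> R.
    by rewrite -natr1 mulrDl.
  have r2 : r / 2 < r by rewrite ltr_pdivrMr// ltr_pMr// ltr1n.
  by apply/andP; split; lra.
have Fdec : nonincreasing_seq F.
  move=> K K' KK; apply/subsetPset => x [[Ux xI] nx]; split=> // -[_ qx]; apply: nx.
  have x01 : 0 <= x < 1 by move: xI; rewrite /J unitP.
  have x0 := proj1 (andP x01).
  split=> //; apply/asboolP => t; rewrite /= in_itv/= => ht.
  have t0 : 0 <= t.
    case/andP: ht => ht _; apply: le_trans ht.
    by rewrite divr_ge0// ltW// expaR_gt0.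
  move: ht; rewrite -(idx_eq ha)// => /eqP ht.
  move/asboolP: qx; apply; rewrite /= in_itv/= -(idx_eq ha)//.
  rewrite (idx_divn ha K (K' - K) t0) (idx_divn ha K (K' - K) x0) subnKC//.
  by rewrite ht.
have F0fin : (mu (F 0%N) < +oo)%E.
  apply: (@le_lt_trans _ _ (mu J)).
    by apply: le_measure; rewrite ?inE//; [exact: measurable_unit|move=> x [[]]].
  by rewrite (@measure_unit R) ltry.
have := @nonincreasing_cvg_mu _ _ _ mu F F0fin mF.
rewrite F0 measure0 => /(_ measurable0 Fdec)/(ge0_cvge0P _)-/(_ (fun n => measure_ge0 mu _) e e0).
move=> [N /(_ N (leqnn N)) hN]; exists N, (q N); split => //.
move=> x [xI qx]; apply: (qP N x) => //; by move: xI; rewrite unitP.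
Qed.

End density.

Import HBSimple.

(** * From indicators to L^1, and a countable dense family *)

Section density_L1.
Variables (R : realType) (a : nat).
Hypothesis ha : (2 <= a)%N.
Local Notation mu := (@completed_lebesgue_measure R).
Local Notation I := (`[0%R, 1%R[%classic : set (lebesgueType R)).

(** Up to a null set [A] is the Borel set [X], to which outer regularity will be applied. *)
Lemma lebesgue_measurableP (A : set (lebesgueType R)) : measurable A ->
  exists X N : set (measurableTypeR R),
    [/\ measurable X, measurable N, lebesgue_measure N = 0%E,
        X `<=` A & A `<=` X `|` N].
Proof.
move=> mA.
have : (completed_algebra_gen (@lebesgue_measure R)).-sigma.-measurable A.
  by rewrite completed_caratheodory_measurable.
rewrite g_sigma_completed_algebra_genE => -[X mX [M [N [mN N0 MN]] XM]].
exists X, N; split; [exact: mX|exact: mN|exact: N0| |].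
  by move=> x Xx; rewrite -XM; left.
by move=> x; rewrite -XM => -[Xx|/MN Nx]; [left|right].
Qed.

Lemma step_approximable_indic (A : set (lebesgueType R)) : measurable A ->
  step_approximable a (fun x => (x \in A)%:R : R[i]).
Proof.
move=> mA e e0; have e20 : 0 < e / 2 by rewrite divr_gt0.
have [X [N [mX mN N0 XA AXN]]] := lebesgue_measurableP mA.
pose X0 : set R := X `&` `[0%R, 1%R[.
have mX0 : measurable (X0 : set (measurableTypeR R)).
  by apply: measurableI => //; exact: measurable_itv.
have X0fin : (lebesgue_measure (X0 : set (measurableTypeR R)) < +oo)%E.
  apply: (@le_lt_trans _ _ (lebesgue_measure (`[0%R, 1%R[%classic : set (measurableTypeR R)))).
    by apply: le_measure; rewrite ?inE// => x [].
  by rewrite lebesgue_measure_itv/= lte_fin ltr01 oppr0 adde0 ltry.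
have [U [oU XU UX]] := lebesgue_regularity_outer mX0 X0fin e20.
have [K [q [hW LU]]] := open_level_set_approx ha oU e20.
pose W : set (lebesgueType R) := (U `&` `[0%R, 1%R[) `\` level_set a K q.
pose V : set (lebesgueType R) := U `\` X0.
have mU : measurable (U : set (measurableTypeR R)) by exact: open_measurable.
have mV : measurable V.
  by apply: lebesgue_measurable_Borel; exact: measurableD.
have mW : measurable W.
  apply: measurableD; last exact: measurable_level_set.
  by apply: measurableI; [exact: lebesgue_measurable_Borel|exact: measurable_unit].
have mN' : measurable (N : set (lebesgueType R)) by exact: lebesgue_measurable_Borel.
(* Inside [0, 1[, [A] and the level set differ only on [D]: [N] is null, [V] is the excess of the
   open set over its Borel core, and [W] is what the cells leave uncovered. *)
pose D : set (lebesgueType R) := ((N : set (lebesgueType R)) `|` V `|` W) `&` I.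
have mNVW : measurable ((N : set (lebesgueType R)) `|` V `|` W).
  by apply: measurableU => //; apply: measurableU.
have mD : measurable D by apply: measurableI => //; exact: measurable_unit.
exists K, (fun p => (q p)%:R).
apply: (@le_trans _ _ (mu D)).
  rewrite measure_L1norm//; last by move=> x [].
  rewrite -[leRHS]mul1e; apply: le_L1norm => [|||x x01].
  - by [].
  - apply: mfunCB; first exact: mfunC_indic.
    exact: (mfunC_step ha (fun p => (q p)%:R)).
  - exact: mfunC_indic.
  rewrite mul1r; have xI : I x by rewrite unitP.
  have [xA|xA] := boolP (x \in A); have [qx|qx] := boolP (q (idx a K x)).
  - by rewrite subrr Normc.normc0 normc_ge0.
  - have -> : x \in D.
      rewrite inE; split => //; move: xA; rewrite inE => /AXN[Xx|Nx]; last by left; left.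
      right; split; first by split => //; apply: XU; split.
      by move=> [_ qx']; rewrite qx' in qx.
    by rewrite subr0.
  - have -> : x \in D.
      rewrite inE; split => //; left; right; split; first by apply: LU; split.
      by move=> [/XA Ax _]; move/negP: xA; apply; rewrite inE.
    by rewrite sub0r normcNr.
  - by rewrite subrr Normc.normc0 normc_ge0.
apply: (@le_trans _ _ (mu ((N : set (lebesgueType R)) `|` V `|` W))).
  by apply: le_measure; rewrite ?inE//; move=> x [].
apply: (le_trans (measureU2 mu (measurableU _ _ mN' mV) mW)).
rewrite (splitr e) EFinD; apply: leeD; last exact: hW.
apply: (le_trans (measureU2 mu mN' mV)).
rewrite -[leRHS]add0e; apply: leeD; last exact: ltW UX.
by rewrite le_eqVlt; apply/orP; left; apply/eqP; exact: N0.
Qed.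

Lemma step_approximable_sum (J : Type) (r : seq J) (F : J -> R -> R[i]) :
  (forall j, mfunC (F j)) -> (forall j, step_approximable a (F j)) ->
  step_approximable a (fun x => \sum_(j <- r) F j x).
Proof.
move=> mF aF; elim: r => [|j r IHr].
  move=> e e0; exists 0, (fun=> 0).
  rewrite (eq_L1norm (g := fun=> 0)) ?L1norm_cst0 ?lee_fin ?ltW//.
  by move=> x _; rewrite big_nil subr0.
have -> : (fun x => \sum_(j <- j :: r) F j x) = (fun x => F j x + \sum_(j <- r) F j x).
  by apply/funext => x; rewrite big_cons.
by apply: step_approximableD; [exact: ha|exact: mF|exact: mfunC_sum|exact: aF|exact: IHr].
Qed.

Lemma step_approximable_sfun (g : {sfun lebesgueType R >-> R}) :
  step_approximable a (fun x => (g x)%:C).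
Proof.
have -> : (fun x => (g x)%:C) = (fun x : R =>
    \sum_(y <- finmap.enum_fset (fset_set (range g)))
      y%:C * (x \in (g @^-1` [set y] : set (lebesgueType R)))%:R).
  apply/funext => x; rewrite fimfunE fsbig_finite//= raddf_sum/=.
  by apply: eq_bigr => y _; rewrite rmorphM/= indicE rmorph_nat.
have mA y : measurable (g @^-1` [set y] : set (lebesgueType R)) by exact: measurable_sfunP.
apply: step_approximable_sum => y.
  by apply: mfunCZ; exact: mfunC_indic.
by apply: step_approximableZ; [exact: ha|exact: mfunC_indic|exact: step_approximable_indic].
Qed.

Lemma L1norm_real (h : R -> R) :
  L1norm (fun x => (h x)%:C) = (\int[mu]_(x in I) `|(h x)%:E|)%E.
Proof.
by rewrite L1normE; apply: eq_integral => x _; rewrite /= expr0n/= addr0 sqrtr_sqr.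
Qed.

Lemma step_approximable_real (h : R -> R) :
  mu.-integrable I (fun x => (h x)%:E) -> step_approximable a (fun x => (h x)%:C).
Proof.
move=> ih; have [g [ig _ cg]] := approximation_sfun_integrable (@measurable_unit R) ih.
have mh : mfunC (fun x => (h x)%:C).
  by apply: mfunC_real; apply/measurable_EFinP; case/integrableP: ih.
apply: step_approximable_lim; [exact: ha|exact: mh|].
move=> e e0; have := proj1 (ge0_cvge0P _) cg e e0; case.
  by move=> n; apply: integral_ge0 => x _; exact: abse_ge0.
move=> N /(_ N (leqnn N)) hN; exists (fun x => (g N x)%:C); split.
- by apply: mfunC_real; apply/measurable_EFinP; case/integrableP: (ig N).
- exact: step_approximable_sfun.
rewrite (eq_L1norm (g := fun x => (h x - g N x)%:C)); last by move=> x _; rewrite rmorphB.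
rewrite L1norm_real; apply: le_trans hN.
by rewrite le_eqVlt; apply/orP; left; apply/eqP; apply: eq_integral.
Qed.

Lemma step_approximable_L1 (f : R -> R[i]) : L1 f -> step_approximable a f.
Proof.
move=> [fRe fIm].
have mh (h : R -> R) : mu.-integrable I (fun x => (h x)%:E) -> mfunC (fun x => (h x)%:C).
  by move=> ih; apply: mfunC_real; apply/measurable_EFinP; case/integrableP: ih.
have -> : f = (fun x => (complex.Re (f x))%:C + 'i%C * (complex.Im (f x))%:C).
  by apply/funext => x; exact: complexE.
apply: step_approximableD; first exact: ha.
- exact: mh.
- by apply: mfunCZ; exact: mh.
- exact: step_approximable_real.
apply: step_approximableZ; first exact: ha.
- exact: mh.
- exact: step_approximable_real.
Qed.

Definition complex_of_rats (p : rat * rat) : R[i] := ratr p.1 +i* ratr p.2.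

Lemma complex_of_rats_dense (z : R[i]) (e : R) : 0 < e ->
  exists p, Normc.normc (z - complex_of_rats p) <= e.
Proof.
move=> e0; have H (t : R) : exists q, `|t - ratr q| <= e / 2.
  have [|q] := @rat_in_itvoo _ t (t + e / 2); first by rewrite ltrDl divr_gt0.
  rewrite in_itv/= => /andP[h1 h2]; exists q; rewrite ler_norml; apply/andP; split; lra.
have [p hp] := H (complex.Re z); have [q hq] := H (complex.Im z).
exists (p, q); apply: (le_trans (normc_le_ReIm _)).
rewrite (splitr e); case: z hp hq => u v /= hp hq; exact: lerD.
Qed.

(* Every index [i] is [logn 2 k] for infinitely many [k], so that each step
   function with rational values occurs infinitely often in the enumeration. *)
Definition step_code (k : nat) : nat * seq (rat * rat) :=
  odflt (0, [::])%N (unpickle (logn 2 k)).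

Definition step_val (k i : nat) : R[i] := complex_of_rats (nth (0, 0) (step_code k).2 i).

Definition step_enum (k : nat) (x : R) : R[i] := step_val k (idx a (step_code k).1 x).

Lemma mfunC_step_enum k : mfunC (step_enum k).
Proof. exact: (mfunC_step ha (step_val k)). Qed.

Lemma step_enum_dense (f : R -> R[i]) (e : R) (k0 : nat) : L1 f -> 0 < e ->
  exists2 k, (k0 <= k)%N & (L1norm (fun x => f x - step_enum k x)%R <= e%:E)%E.
Proof.
move=> Lf e0; have e20 : 0 < e / 2 by rewrite divr_gt0.
have mf : mfunC f by case/L1P : Lf.
have [K [v hv]] := step_approximable_L1 Lf e20.
have [p hp] := choice (fun i => complex_of_rats_dense (v i) e20).
pose s := mkseq p (a ^ K).
(* The exponent of 2 encodes the step function; the power of 3 pushes [k] beyond [k0] without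
   affecting that exponent. *)
pose k := (2 ^ pickle (K, s) * 3 ^ k0)%N.
have kE : step_code k = (K, s).
  rewrite /step_code /k lognM ?expn_gt0// !lognX.
  by rewrite (_ : logn 2 3 = 0)%N// muln0 addn0 logn_prime// eqxx muln1 pickleK.
exists k.
  rewrite (leq_trans (ltnW (ltn_expl k0 (isT : 1 < 3)%N)))// leq_pmull// expn_gt0//.
have mv : mfunC (fun x => v (idx a K x)) by exact: mfunC_step.
rewrite (eq_L1norm (g := fun x => (f x - v (idx a K x)) + (v (idx a K x) - step_enum k x))).
  have m1 := mfunCB mf mv; have m2 := mfunCB mv (mfunC_step_enum k).
  apply: (le_trans (L1normD m1 m2)).
  rewrite (splitr e) EFinD; apply: leeD => //.
  apply: L1norm_le_cst => [||x xI]; [exact: ltW|exact: m2|].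
  by rewrite /step_enum /step_val kE/= nth_mkseq ?idx_lt// hp.
by move=> x _; rewrite addrA subrK.
Qed.

End density_L1.

(** * The universal series *)

Section universal_series.
Variables (R : realType) (a : nat).
Hypothesis ha : (2 <= a)%N.
Local Notation mu := (@completed_lebesgue_measure R).
Local Notation fs := (@step_enum R a).

(** The least k with n < N k.+1 is the block of n; it exists because strict growth gives k <= N
    k. *)
Lemma block_index (N : nat -> nat) : (forall k, (N k < N k.+1)%N) ->
  exists blk : nat -> nat,
    (forall n, (N 0 <= n)%N -> (N (blk n) <= n < N (blk n).+1)%N) /\
    (forall k n, (N k <= n < N k.+1)%N -> blk n = k).
Proof.
move=> Nlt.
have Nge k : (k <= N k)%N by elim: k => // k IHk; exact: leq_ltn_trans IHk (Nlt k).
have Nle : {homo N : i j / (i <= j)%N}.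
  by apply: homo_leq => // [? ? ?|k]; [exact: leq_trans|exact: ltnW].
have /choice[blk hblk] : forall n, exists k, (N 0 <= n)%N -> (N k <= n < N k.+1)%N.
  move=> n.
  have ex : exists k, (n < N k.+1)%N by exists n; exact: leq_trans (Nge n.+1).
  exists (ex_minn ex); case: ex_minnP => -[|k] nk mink N0n; rewrite nk andbT//.
  by rewrite leqNgt; apply/negP => /mink; rewrite ltnn.
exists blk; split => // k n /andP[h1 h2].
have /andP[h3 h4] : (N (blk n) <= n < N (blk n).+1)%N.
  by apply: hblk; apply: leq_trans h1; exact: Nle.
have [lt|lt|//] := ltngtP (blk n) k.
  by have := leq_trans h4 (leq_trans (Nle _ _ lt) h1); rewrite ltnn.
by have := leq_trans h2 (leq_trans (Nle _ _ lt) h3); rewrite ltnn.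
Qed.

Lemma block_sequence (eta : nat -> R) : (forall k, 0 < eta k) ->
  exists (N : nat -> nat) (c : nat -> nat -> R[i]) (d : nat -> nat -> bool)
    (B : nat -> set (lebesgueType R)),
  [/\ (N 0 = 1)%N /\ (forall k, (N k < N k.+1)%N),
      (forall k n, (N k <= n < N k.+1)%N -> Normc.normc (c k n) <= 1 / 2 ^+ k) /\
      (forall k n, (N k <= n)%N -> (n.+1 < N k.+1)%N ->
         Normc.normc (c k n.+1) <= Normc.normc (c k n)) /\
      (forall k, Normc.normc (c k.+1 (N k.+1)) <= Normc.normc (c k (N k.+1).-1)),
      forall k, measurable (B k) /\ (mu (B k) <= (eta k)%:E)%E,
      (forall k (x : R), 0 <= x < 1 -> ~ B k x ->
         walsh_sum a (d k) (c k) (N k) (N k.+1) x = fs k x) &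
      forall k n, (N k <= n <= N k.+1)%N ->
        (L1norm (walsh_sum a (d k) (c k) (N k) n) <=
         2%:E * L1norm (fs k) + (eta k)%:E)%E].
Proof.
move=> eta0.
(* The guard [0 < beta] sits inside [spec] so that [choice] yields a total function; the caps that
   actually occur are shown positive in [hs]. *)
pose spec (p : nat * nat * R)
    (q : nat * (nat -> R[i]) * (nat -> bool) * set (lebesgueType R)) :=
  let '(k, N0, beta) := p in let '(N1, c, d, B) := q in 0 < beta ->
  [/\ (N0 < N1)%N,
      (forall n, (N0 <= n < N1)%N -> 0 < Normc.normc (c n) <= beta) /\
      (forall n, (N0 <= n)%N -> (n.+1 < N1)%N -> Normc.normc (c n.+1) <= Normc.normc (c n)),
      measurable B /\ (mu B <= (eta k)%:E)%E,
      (forall x : R, 0 <= x < 1 -> ~ B x -> walsh_sum a d c N0 N1 x = fs k x) &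
      forall n, (N0 <= n <= N1)%N -> (L1norm (walsh_sum a d c N0 n) <=
        2%:E * L1norm (fs k) + (eta k)%:E)%E].
have /choice[G hG] : forall p, exists q, spec p q.
  move=> [[k N0] beta].
  have [b0|b0] := ltP 0 beta; last first.
    by exists (0%N, fun=> 0, fun=> false, set0) => /(le_lt_trans b0); rewrite ltxx.
  have [N1 [c [d [B hB]]]] :=
    @step_block R a ha (step_code k).1 (step_val R k) N0 beta (eta k) b0 (eta0 k).
  by exists (N1, c, d, B).
(* The next cap is the smaller of the last modulus used, for monotonicity across the junction, and
   2^-(k+1), for convergence to 0. *)
pose next k (s : nat * R) := let q := G (k, s.1, s.2) in
  (q.1.1.1, Num.min (Normc.normc (q.1.1.2 q.1.1.1.-1)) (1 / 2 ^+ k.+1)).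
pose s := fix s k := if k is k'.+1 then next k' (s k') else (1%N, 1 : R).
pose q k := G (k, (s k).1, (s k).2).
have h2 k : 0 < 1 / 2 ^+ k :> R by rewrite divr_gt0// exprn_gt0.
have pred_in m n : (m < n)%N -> (m <= n.-1 < n)%N by case: n => // n; rewrite ltnS => ->/=.
have hs k : 0 < (s k).2 <= 1 / 2 ^+ k.
  elim: k => [|k /andP[IHk _]]; first by rewrite /= expr0 divr1 ltr01 lexx.
  have := hG (k, (s k).1, (s k).2); rewrite /spec.
  case E : (G _) => [[[N1 c] d] B] /(_ IHk)[N01 [hc _] _ _ _].
  rewrite /= /next E/= lt_min h2 andbT ge_min lexx orbT andbT.
  by have /andP[] := hc _ (pred_in _ _ N01).
exists (fun k => (s k).1), (fun k => (q k).1.1.2), (fun k => (q k).1.2), (fun k => (q k).2).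
have H k := hG (k, (s k).1, (s k).2).
have Hq k : spec (k, (s k).1, (s k).2) ((s k.+1).1, (q k).1.1.2, (q k).1.2, (q k).2).
  by have := H k; rewrite /q /=; case: (G _) => [[[? ?] ?] ?].
have {}Hq k := Hq k (proj1 (andP (hs k))).
split.
- by split => // k; have [] := Hq k.
- split; last split.
  + move=> k n nk; have [_ [/(_ n nk)/andP[_ h] _] _ _ _] := Hq k.
    by apply: (le_trans h); have /andP[] := hs k.
  + by move=> k; have [_ [_ h] _ _ _] := Hq k.
  + move=> k; have [lt [h _] _ _ _] := Hq k.+1.
    have := h (s k.+1).1; rewrite leqnn lt => /(_ isT)/andP[_ h'].
    by apply: (le_trans h'); rewrite /= /next ge_min lexx.
- by move=> k; have [] := Hq k.
- by move=> k; have [] := Hq k.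
- by move=> k; have [] := Hq k.
Qed.

Lemma universal_blocks (eta : nat -> R) : (forall k, 0 < eta k) ->
  exists (N : nat -> nat) (c : nat -> R[i]) (d : nat -> bool)
    (B : nat -> set (lebesgueType R)),
  [/\ (N 0 = 1)%N /\ (forall k, (N k < N k.+1)%N),
      (forall n, (1 <= n)%N -> Normc.normc (c n.+1) <= Normc.normc (c n)) /\
      Normc.normc (c n) @[n --> \oo] --> (0 : R),
      forall k, measurable (B k) /\ (mu (B k) <= (eta k)%:E)%E,
      (forall k (x : R), 0 <= x < 1 -> ~ B k x ->
         walsh_sum a d c (N k) (N k.+1) x = fs k x) &
      forall k n, (N k <= n <= N k.+1)%N -> (L1norm (walsh_sum a d c (N k) n) <=
         2%:E * L1norm (fs k) + (eta k)%:E)%E].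
Proof.
move=> /block_sequence[N [c [d [B [[N01 Nlt] [cle [cdec cjump]] hB hE hL]]]]].
have [blk [blk1 blk2]] := block_index Nlt.
pose C n := c (blk n) n; pose D n := d (blk n) n.
have sumE k n x : (n <= N k.+1)%N ->
    walsh_sum a D C (N k) n x = walsh_sum a (d k) (c k) (N k) n x.
  move=> nN; apply: eq_walsh_sum => m /andP[m1 m2].
  by rewrite /D /C (blk2 k)// m1 (leq_trans m2).
have Cdec n : (1 <= n)%N -> Normc.normc (C n.+1) <= Normc.normc (C n).
  move=> n1; have /andP[b1 b2] := blk1 n (eq_ind_r (fun m => m <= n)%N n1 N01).
  rewrite /C; have [lt|ge] := ltnP n.+1 (N (blk n).+1).
    by rewrite (blk2 (blk n) n.+1) ?lt ?(leq_trans b1)// cdec.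
  have e : n.+1 = N (blk n).+1 by apply/eqP; rewrite eqn_leq b2 ge.
  rewrite (blk2 (blk n).+1 n.+1); last by rewrite -e leqnn/= e Nlt.
  by have := cjump (blk n); rewrite -e.
exists N, C, D, B; split => //.
- split => //; apply/cvgrPdist_le => e e0.
  have [k _ hk] := @exists_expn_ge R 2 isT 1 e ler01 e0 0.
  exists (N k) => // n /= Nn.
  rewrite sub0r normrN ger0_norm ?normc_ge0//; apply: le_trans hk.
  have Nk : (1 <= N k)%N by rewrite -N01; elim: k {Nn} => // k /leq_trans; apply; exact: ltnW.
  have : Normc.normc (C n) <= Normc.normc (C (N k)).
    rewrite -(subnK Nn); elim: (n - N k)%N => [//|m IHm].
    by rewrite addSn; apply: le_trans (Cdec _ _) IHm; rewrite (leq_trans Nk)// leq_addl.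
  move/le_trans; apply; rewrite /C (blk2 k) ?leqnn ?Nlt//.
  by apply: cle; rewrite leqnn Nlt.
- by move=> k x xI nB; rewrite sumE// hE.
- move=> k n nN; rewrite (eq_L1norm (g := walsh_sum a (d k) (c k) (N k) n)); first exact: hL.
  by move=> x _; apply: sumE; case/andP: nN.
Qed.

Definition step_norm (k : nat) : R := fine (L1norm (fs k)).

Lemma step_normE k : L1norm (fs k) = (step_norm k)%:E.
Proof. by rewrite /step_norm /step_enum (L1norm_step ha (step_val R k)). Qed.

Lemma step_norm_ge0 k : 0 <= step_norm k.
Proof. by rewrite -lee_fin -step_normE L1norm_pos. Qed.

(* Greedy choice: [f_n] is subtracted from the current residual as soon as this
   halves the bound [F / 2 ^ j] on the norm of the residual. *)
Lemma greedy_selection (f : R -> R[i]) (F : R) (k1 : nat) :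
  mfunC f -> L1norm f = F%:E -> 0 < F ->
  exists sel : nat -> bool,
  [/\ forall k, sel k -> (k1 <= k)%N,
      forall n, \sum_(0 <= k < n) (sel k)%:R * step_norm k <= 3 * F &
      L1norm (fun x => f x - \sum_(0 <= k < n) (sel k)%:R * fs k x)
        @[n --> \oo] --> 0%E].
Proof.
move=> mf fF F0.
(* A state consists of the current residual and the number j of selections made so far. *)
pose ok n (s : (R -> R[i]) * nat) := (k1 <= n)%N &&
  (L1norm (fun x => s.1 x - fs n x)%R <= (F / 2 ^+ s.2.+1)%:E)%E.
pose next n (s : (R -> R[i]) * nat) :=
  if ok n s then (fun x => s.1 x - fs n x, s.2.+1) else s.
pose s := fix s n := if n is n'.+1 then next n' (s n') else (f, 0%N).
pose sel n := ok n (s n).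
have sE n : s n.+1 = if sel n then (fun x => (s n).1 x - fs n x, (s n).2.+1) else s n.
  by [].
pose rho n x := f x - \sum_(0 <= k < n) (sel k)%:R * fs k x.
have rhoE n : (s n).1 = rho n.
  elim: n => [|n IHn]; first by apply/funext => x; rewrite /rho big_geq// subr0.
  apply/funext => x; rewrite sE /rho big_nat_recr//= opprD addrA -/(rho n x) -IHn.
  by case: ifP => _; rewrite ?mul1r ?mul0r ?subr0.
have mrho n : mfunC (rho n).
  apply: mfunCB; first exact: mf.
  by apply: mfunC_sum => k; apply: mfunCZ; exact: mfunC_step_enum.
have F2 j : F / 2 ^+ j = F / 2 ^+ j.+1 + F / 2 ^+ j.+1.
  by rewrite exprS; field; rewrite expf_neq0.
have F2_0 j : 0 < F / 2 ^+ j by rewrite divr_gt0// exprn_gt0.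
have nrho n : (L1norm (rho n) <= (F / 2 ^+ (s n).2)%:E)%E.
  elim: n => [|n IHn].
    rewrite /= expr0 divr1 -fF (eq_L1norm (g := f))// => x _.
    by rewrite /rho big_geq// subr0.
  have [sn|sn] := boolP (sel n); last first.
    by rewrite -rhoE sE (negPf sn) rhoE.
  by rewrite -rhoE sE sn/=; case/andP: sn.
(* A selected f_n is the difference of two consecutive residuals. *)
have nsel n : sel n -> step_norm n <= F / 2 ^+ (s n).2 + F / 2 ^+ (s n).2.+1.
  move=> sn; rewrite -lee_fin -step_normE EFinD.
  rewrite (eq_L1norm (g := fun x => rho n x - (rho n x - fs n x))); last first.
    by move=> x _; rewrite opprB addrC subrK.
  have md : mfunC (fun x => rho n x - fs n x).
    by apply: mfunCB; [exact: mrho|exact: mfunC_step_enum].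
  apply: (le_trans (L1normB (mrho n) md)); apply: leeD; first exact: nrho.
  by case/andP: sn => _; rewrite rhoE.
exists sel; split.
- by move=> k /andP[].
- move=> n.
  (* A selection costs at most F / 2^j + F / 2^(j+1) = 3 F / 2^(j+1), exactly the amount by which
     the budget 3 F / 2^j drops, so this sum never increases. *)
  suff : \sum_(0 <= k < n) (sel k)%:R * step_norm k + 3 * (F / 2 ^+ (s n).2) <= 3 * F.
    by apply: le_trans; rewrite lerDl mulr_ge0// ltW.
  elim: n => [|n IHn]; first by rewrite big_geq// add0r expr0 divr1.
  rewrite sE big_nat_recr//=; have [sn|sn] := boolP (sel n); last by rewrite mul0r addr0.
  have := nsel n sn; have := F2 (s n).2; rewrite mul1r/=; move: IHn.
  set S := \sum_(0 <= k < n) _; set j := (s n).2.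
  move: (F / 2 ^+ j) (F / 2 ^+ j.+1) (step_norm n) => u v t; lra.
- have jle n m : (n <= m)%N -> ((s n).2 <= (s m).2)%N.
    move=> /subnK <-; elim: (m - n)%N => [//|i IHi].
    by rewrite addSn sE; case: ifP => //= _; exact: leqW.
  have jeq n m : (n <= m)%N -> (s m).2 = (s n).2 -> s m = s n.
    move=> /subnK <-; elim: (m - n)%N => [//|i IHi].
    rewrite addSn sE; case: ifP => /= [_|_]; last exact: IHi.
    by move=> e; have := jle n (i + n)%N (leq_addl _ _); rewrite -e ltnn.
  (* Density supplies an index k >= n whose f_k halves the bound for the residual at n. Either the
     counter has grown before k is reached, or the state is still the same and k gets selected. *)
  have jinf J : exists n, (J <= (s n).2)%N.
    elim: J => [|J [n hn]]; first by exists 0%N.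
    have Lrho : L1 (rho n).
      by apply/L1P; split; [exact: mrho|exact: le_lt_trans (nrho n) (ltry _)].
    have [k nk hk] := @step_enum_dense R a ha _ (F / 2 ^+ (s n).2.+1) (maxn n k1) Lrho (F2_0 _).
    have [nk' k1k] : (n <= k)%N /\ (k1 <= k)%N by move: nk; rewrite geq_max => /andP[].
    have [e|ne] := eqVneq (s k).2 (s n).2; last first.
      exists k; apply: leq_ltn_trans hn _; rewrite ltn_neqAle eq_sym ne; exact: jle.
    exists k.+1; rewrite sE.
    have -> : sel k by rewrite /sel /ok k1k (jeq _ _ nk' e) rhoE hk.
    by rewrite /= e ltnS.
  apply/ge0_cvge0P; first by move=> n; exact: L1norm_pos.
  move=> e e0; have [J _ hJ] := @exists_expn_ge R 2 isT F e (ltW F0) e0 0.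
  have [n hn] := jinf J; exists n => m nm.
  apply: (le_trans (nrho m)); rewrite lee_fin; apply: le_trans hJ.
  rewrite ler_pM2l// lef_pV2 ?posrE ?exprn_gt0// ler_weXn2l// ?ler1n//.
  exact: leq_trans hn (jle _ _ nm).
Qed.

End universal_series.

(** Adding the remaining tail, 2 to the power -max(k1, n), makes the inequality inductive. *)
Lemma sum_geometric_tail (R : realFieldType) (k1 n : nat) :
  \sum_(0 <= k < n | (k1 <= k)%N) 1 / 2 ^+ k.+1 <= 1 / 2 ^+ k1 :> R.
Proof.
have p k : 0 < 1 / 2 ^+ k :> R by rewrite divr_gt0// exprn_gt0.
suff : \sum_(0 <= k < n | (k1 <= k)%N) 1 / 2 ^+ k.+1 + 1 / 2 ^+ (maxn k1 n) <=
    1 / 2 ^+ k1 :> R.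
  by apply: le_trans; rewrite lerDl ltW.
elim: n => [|n IHn]; first by rewrite big_geq// add0r maxn0.
rewrite big_mkcond big_nat_recr//= -big_mkcond/=.
have [kn|nk] := leqP k1 n.
  rewrite (maxn_idPr (leqW kn)); rewrite (maxn_idPr kn) in IHn.
  have e : 1 / 2 ^+ n = 1 / 2 ^+ n.+1 + 1 / 2 ^+ n.+1 :> R.
    by rewrite exprS; field; rewrite expf_neq0.
  by rewrite -addrA -e.
by rewrite addr0 (maxn_idPl nk); rewrite (maxn_idPl (ltnW nk)) in IHn.
Qed.

(** The exceptional sets have total measure at most eps / 2, half of what is allowed, which leaves
    room for the strict inequality. *)
Lemma measure_setD_bigcup_gt d (T : measurableType d) (R : realType)
    (mu : {measure set T -> \bar R}) (I : set T) (B : nat -> set T) (eps : R) :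
  measurable I -> mu I = 1%E -> 0 < eps ->
  (forall k, measurable (B k) /\ (mu (B k) <= (eps / 2 * (1 / 2 ^+ k.+1))%:E)%E) ->
  measurable (I `\` \bigcup_k B k) /\ ((1 - eps)%:E < mu (I `\` \bigcup_k B k))%E.
Proof.
move=> mI muI e0 hB.
have mU : measurable (\bigcup_k B k) by apply: bigcupT_measurable => k; case: (hB k).
have mE : measurable (I `\` \bigcup_k B k) by apply: measurableD.
split => //.
have hU : (mu (\bigcup_k B k) <= (eps / 2)%:E)%E.
  apply: (@le_trans _ _ (\sum_(0 <= k <oo) mu (B k))%E).
    by apply: measure_sigma_subadditive => // k; case: (hB k).
  apply: lime_le; first by apply: is_cvg_nneseries.
  apply: nearW => n.
  apply: (@le_trans _ _ (\sum_(0 <= k < n) (eps / 2 * (1 / 2 ^+ k.+1))%:E)%E).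
    by apply: lee_sum => k _; case: (hB k).
  rewrite sumEFin lee_fin -big_distrr/= ger_pMr ?divr_gt0//.
  by apply: (le_trans (sum_geometric_tail R 0 n)); rewrite expr0 divr1.
have h1 : (1 <= mu (I `\` \bigcup_k B k) + (eps / 2)%:E)%E.
  rewrite -muI.
  apply: (@le_trans _ _ (mu ((I `\` \bigcup_k B k) `|` \bigcup_k B k))).
    apply: le_measure; rewrite ?inE//; first exact: measurableU.
    by move=> x xI; have [xB|xB] := pselect ((\bigcup_k B k) x); [right|left].
  by apply: (le_trans (measureU2 mu mE mU)); exact: leeD2l.
have := h1; case: (mu _) => [r| |]; rewrite ?ltry// => h2.
by rewrite -EFinD lee_fin in h2; rewrite lte_fin; lra.
Qed.

(** * The subseries attached to a given function *)

Section assembly.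
Variables (R : realType) (a : nat).
Hypothesis ha : (2 <= a)%N.
Local Notation I := (`[0%R, 1%R[%classic : set (lebesgueType R)).
Local Notation fs := (@step_enum R a).

Lemma subseries_approximation (N : nat -> nat) (c : nat -> R[i]) (d : nat -> bool)
    (B : nat -> set (lebesgueType R)) (eps : R) (f : R -> R[i]) :
  0 < eps -> N 0%N = 1%N -> (forall k, (N k < N k.+1)%N) ->
  (forall k (x : R), 0 <= x < 1 -> ~ B k x -> walsh_sum a d c (N k) (N k.+1) x = fs k x) ->
  (forall k n, (N k <= n <= N k.+1)%N -> (L1norm (walsh_sum a d c (N k) n) <=
     2%:E * L1norm (fs k) + (eps / 2 * (1 / 2 ^+ k.+1))%:E)%E) ->
  L1 f -> L1norm f != 0%E ->
  exists (g : R -> R[i]) (delta : nat -> bool),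
    [/\ L1 g, (forall x, (I `\` \bigcup_k B k) x -> g x = f x),
        L1norm (fun x => walsh_sum a delta c 1 m.+1 x - g x) @[m --> \oo] --> 0%E &
        forall m : nat, (1 <= m)%N ->
          (L1norm (walsh_sum a delta c 1 m.+1) <= 12%:E * L1norm f)%E].
Proof.
move=> e0 N0 Nlt hE hL /L1P[mf ff] fn0.
pose F := fine (L1norm f).
have fF : L1norm f = F%:E by rewrite /F fineK// ge0_fin_numE// L1norm_pos.
have F0 : 0 < F.
  by rewrite lt_neqAle -lee_fin -fF L1norm_pos andbT; move: fn0; rewrite fF eqe eq_sym.
pose eta k : R := eps / 2 * (1 / 2 ^+ k.+1).
have eta0 k : 0 < eta k by rewrite mulr_gt0 ?divr_gt0 ?exprn_gt0.
(* Selecting only from [k1] on makes the errors [eta] of the selected blocks add up to at most F. *)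
have [k1 _ hk1] := @exists_expn_ge R 2 isT (eps / 2) F (ltW (divr_gt0 e0 (ltr0n _ 2))) F0 0.
have [sel [selk selsum selcvg]] := greedy_selection ha k1 mf fF F0.
have [blk [blk1 blk2]] := block_index Nlt.
pose delta n := d n && sel (blk n).
(* [w k] bounds all partial sums inside block k. Summed over k it gives twice 3 F from the selected
   norms and F from the errors. *)
pose w k := (sel k)%:R * (2 * step_norm R a k + eta k).
have w0 k : 0 <= w k.
  by rewrite mulr_ge0// addr_ge0 ?mulr_ge0 ?step_norm_ge0// ltW.
have etasum n : \sum_(0 <= k < n) (sel k)%:R * eta k <= F.
  apply: le_trans hk1.
  have -> : eps / 2 / 2 ^+ k1 = eps / 2 * (1 / 2 ^+ k1) by rewrite mul1r.
  apply: (@le_trans _ _ (eps / 2 * \sum_(0 <= k < n | (k1 <= k)%N) 1 / 2 ^+ k.+1)).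
    rewrite big_distrr/= [leRHS]big_mkcond/=; apply: ler_sum => k _.
    case sk : (sel k); first by rewrite (selk k sk) -[leRHS]mul1r; exact: lexx.
    by rewrite mul0r; case: ifP => // _; exact: ltW (eta0 k).
  by rewrite ler_wpM2l ?sum_geometric_tail// ltW// divr_gt0.
have wsum n : \sum_(0 <= k < n) w k <= 7 * F.
  rewrite (eq_bigr (fun k => 2 * ((sel k)%:R * step_norm R a k) + (sel k)%:R * eta k)).
    rewrite big_split/= -big_distrr/=.
    have := selsum n; have := etasum n.
    by move: (\sum_(_ <= _ < _) _) (\sum_(_ <= _ < _) _) => u v; lra.
  by move=> k _; rewrite /w; ring.
pose P k n x := (sel k)%:R * walsh_sum a d c (N k) n x : R[i].
pose Q k x := P k (N k.+1) x.
have mP k n : mfunC (P k n) by apply: mfunCZ; exact: mfunC_walsh_sum.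
have msf k : mfunC (fun x => (sel k)%:R * fs k x) by apply: mfunCZ; exact: mfunC_step_enum.
have PE k n x : (n <= N k.+1)%N -> walsh_sum a delta c (N k) n x = P k n x.
  move=> nN; rewrite /P /walsh_sum big_distrr/=; apply: eq_big_nat => m /andP[m1 m2].
  rewrite /delta (blk2 k); last by rewrite m1 (leq_trans m2).
  by rewrite -mulnb natrM; ring.
have NleS k : (N 0%N <= N k)%N by elim: k => // k IHk; exact: leq_trans IHk (ltnW (Nlt k)).
have QE k x : walsh_sum a delta c 1 (N k) x = \sum_(0 <= j < k) Q j x.
  rewrite -N0; elim: k => [|k IHk]; first by rewrite /walsh_sum !big_geq.
  rewrite big_nat_recr//= -IHk (walsh_sum_cat _ _ _ (p := N k)); last by rewrite NleS ltnW.
  by rewrite (PE k (N k.+1)).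
have nP k n : (N k <= n <= N k.+1)%N -> (L1norm (P k n) <= (w k)%:E)%E.
  move=> nN; have h := hL k n nN.
  apply: (@le_trans _ _ ((sel k)%:R%:E * L1norm (walsh_sum a d c (N k) n))%E).
    apply: le_L1norm => [|||x _]; [by []|exact: mP|exact: mfunC_walsh_sum|].
    by rewrite Normc.normcM normc_natr.
  rewrite /w EFinM; apply: lee_wpmul2l; first by rewrite lee_fin.
  by apply: (le_trans h); rewrite step_normE// -EFinM -EFinD.
have mwd m n : mfunC (walsh_sum a delta c m n) by exact: mfunC_walsh_sum.
have nsf k : (L1norm (fun x => (sel k)%:R * fs k x)%R <= ((sel k)%:R * step_norm R a k)%:E)%E.
  rewrite EFinM -step_normE//; apply: le_L1norm => [|||x _].
  - by [].
  - exact: msf.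
  - exact: mfunC_step_enum.
  - by rewrite Normc.normcM normc_natr.
(* The error of block k as a copy of its step function, zero on [0, 1[ off [B k]. The norms add up
   to at most 7 F + 3 F. *)
pose h k x := Q k x - (sel k)%:R * fs k x.
have mh k : mfunC (h k) by apply: mfunCB; [exact: mP|exact: msf].
have hsum n : (\sum_(0 <= k < n) L1norm (h k) <= (10 * F)%:E)%E.
  apply: (@le_trans _ _ (\sum_(0 <= k < n) (w k + (sel k)%:R * step_norm R a k)%:E)%E).
    apply: lee_sum => k _; apply: (le_trans (L1normB (mP k (N k.+1)) (msf k))).
    rewrite EFinD; apply: leeD; last exact: nsf.
    by apply: nP; rewrite leqnn ltnW.
  rewrite sumEFin lee_fin big_split/=; have := wsum n; have := selsum n.
  move: (\sum_(_ <= _ < _) _) (\sum_(_ <= _ < _) _) => u v; lra.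
have [H [mH fH H0 cH]] := L1_series_limit mh hsum.
(* On E every [h k] vanishes, hence so does [H]; off E the function g absorbs the accumulated
   errors. *)
exists (fun x => f x + H x), delta.
have mg : mfunC (fun x => f x + H x) by exact: mfunCD.
split.
- apply/L1P; split; first exact: mg.
  by apply: (le_lt_trans (L1normD mf mH)); exact: lte_add_pinfty.
- move=> x [xI xB]; rewrite H0 ?addr0// => k; rewrite /h /Q /P hE ?subrr//.
  by move=> Bx; apply: xB; exists k.
- have mhs k : mfunC (fun x => \sum_(0 <= j < k) h j x - H x).
    by apply: mfunCB; [apply: mfunC_sum; exact: mh|exact: mH].
  have mr k : mfunC (fun x => f x - \sum_(0 <= j < k) (sel j)%:R * fs j x).
    by apply: mfunCB; [exact: mf|apply: mfunC_sum; exact: msf].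
  have wcvg : w k @[k --> \oo] --> (0 : R).
    apply: cvg_series_cvg_0; apply: nondecreasing_is_cvgn.
      by apply: nondecreasing_series => k _ _; exact: w0.
    by exists (7 * F) => _ [n _ <-]; exact: wsum.
  apply/ge0_cvge0P; first by move=> m; exact: L1norm_pos.
  move=> e ep; have e3 : 0 < e / 3 by rewrite divr_gt0.
  have [n1 h1] := proj1 (ge0_cvge0P (fun n => L1norm_pos _)) cH _ e3.
  have [n2 h2] := proj1 (ge0_cvge0P (fun n => L1norm_pos _)) selcvg _ e3.
  have [n3 _ h3] : \forall n \near \oo, w n <= e / 3.
    move/cvgrPdist_le : wcvg => /(_ _ e3); apply: filterS => n.
    by rewrite sub0r normrN ger0_norm.
  pose n0 := maxn n1 (maxn n2 n3).
  exists (N n0) => m Nm.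
  have m1 : (N 0%N <= m.+1)%N by rewrite N0.
  pose k := blk m.+1.
  have /andP[b1 b2] := blk1 m.+1 m1; rewrite -/k in b1 b2.
  have kn : (n0 <= k)%N.
    rewrite leqNgt; apply/negP => kn0.
    have : (N k.+1 <= N n0)%N.
      rewrite -(subnK kn0); elim: (n0 - k.+1)%N => // i IHi.
      by rewrite addSn; exact: leq_trans IHi (ltnW (Nlt _)).
    by move=> /(leq_trans b2) /leq_trans /(_ Nm); rewrite ltnNge leqnSn.
  have [k_1 [k_2 k_3]] : (n1 <= k)%N /\ (n2 <= k)%N /\ (n3 <= k)%N.
    by move: kn; rewrite !geq_max => /andP[-> /andP[-> ->]].
  (* Three small terms: the tail of the series of the [h j], the greedy residual, and the current
     incomplete block, whose norm is at most [w k]. *)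
  have pE x : walsh_sum a delta c 1 m.+1 x - (f x + H x) =
      ((\sum_(0 <= j < k) h j x - H x) - (f x - \sum_(0 <= j < k) (sel j)%:R * fs j x))
      + P k m.+1 x.
    rewrite (walsh_sum_cat _ _ _ (p := N k)); last by rewrite -N0 NleS b1.
    rewrite QE (PE k) ?(ltnW b2)// (eq_bigr (fun j => h j x + (sel j)%:R * fs j x)).
      by rewrite big_split/=; ring.
    by move=> j _; rewrite /h subrK.
  rewrite (eq_L1norm (fun x _ => pE x)).
  apply: (le_trans (L1normD (mfunCB (mhs k) (mr k)) (mP k m.+1))).
  have {}e3 : e = (e / 3 + e / 3) + e / 3 by field.
  rewrite [in leRHS]e3 EFinD; apply: leeD.
    apply: (le_trans (L1normB (mhs k) (mr k))); rewrite EFinD; apply: leeD.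
      exact: h1.
    exact: h2.
  apply: (le_trans (nP k m.+1 _)); first by rewrite b1 ltnW.
  by rewrite lee_fin; exact: h3.
- move=> m m1.
  have m1' : (N 0%N <= m.+1)%N by rewrite N0.
  pose k := blk m.+1.
  have /andP[b1 b2] := blk1 m.+1 m1'; rewrite -/k in b1 b2.
  have pE x : walsh_sum a delta c 1 m.+1 x = \sum_(0 <= j < k) Q j x + P k m.+1 x.
    rewrite (walsh_sum_cat _ _ _ (p := N k)); last by rewrite -N0 NleS b1.
    by rewrite QE (PE k) ?(ltnW b2).
  rewrite (eq_L1norm (fun x _ => pE x)).
  have mQ : mfunC (fun x => \sum_(0 <= j < k) Q j x).
    by apply: mfunC_sum => j; exact: mP.
  apply: (le_trans (L1normD mQ (mP k m.+1))).
  apply: (@le_trans _ _ (\sum_(0 <= j < k) (w j)%:E + (w k)%:E)%E).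
    apply: leeD; last by apply: nP; rewrite b1 ltnW.
    apply: (le_trans (L1norm_sum _ _ _)); first by move=> j; exact: mP.
    by apply: lee_sum => j _; apply: nP; rewrite leqnn ltnW.
  rewrite sumEFin -EFinD fF -EFinM lee_fin -big_nat_recr//=.
  by apply: (le_trans (wsum k.+1)); rewrite ler_wpM2r ?ler_nat// ltW.
Qed.

End assembly.

Unset Implicit Arguments.

Theorem theorem1p6 (R : realType) (a : nat) (ha : (2 <= a)%N)
    (eps : R) (heps : 0 < eps < 1) :
  exists (E : set R) (c : nat -> R[i]),
    lebesgue_measurable E /\
    (E `<=` `[0, 1[) /\
    ((1 - eps)%:E < completed_lebesgue_measure E)%E /\
    (forall i : nat, (1 <= i)%N ->
       Normc.normc (c i.+1) <= Normc.normc (c i)) /\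
    (Normc.normc (c i) @[i --> \oo] --> (0 : R)) /\
    forall f : R -> R[i], L1 f ->
      exists (g : R -> R[i]) (delta : nat -> bool),
        L1 g /\
        (forall x, E x -> g x = f x) /\
        (L1norm (fun x => walsh_psum a delta c m x - g x) @[m --> \oo] --> 0%E) /\
        (forall m : nat, (1 <= m)%N ->
           (L1norm (walsh_psum a delta c m)
              <= 12%:E * L1norm f)%E).
Proof.
have e0 : 0 < eps by case/andP: heps.
have eta0 k : 0 < eps / 2 * (1 / 2 ^+ k.+1).
  by rewrite mulr_gt0 ?divr_gt0 ?exprn_gt0.
have [N [c [d [B [[N0 Nlt] [cdec ccvg] hB hE hL]]]]] := universal_blocks ha eta0.
have [mE muE] := measure_setD_bigcup_gt (@measurable_unit R) (@measure_unit R) e0 hB.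
exists (`[0%R, 1%R[%classic `\` \bigcup_k B k), c.
split; first exact: mE.
split; first by move=> x [].
split; first exact: muE.
split; first exact: cdec.
split; first exact: ccvg.
move=> f Lf; have [fz|fnz] := eqVneq (L1norm f) 0%E.
  (* A function of norm 0 gives the greedy choice no scale F to work with; here g = f, and the zero
     series converges to it in norm. *)
  have ps0 m x : walsh_psum a (fun=> false) c m x = 0.
    by rewrite /walsh_psum big1// => k _; rewrite !mul0r.
  exists f, (fun=> false); split; first exact: Lf.
  split; first by [].
  have [mf _] := proj1 (L1P f) Lf.
  split.
    rewrite (_ : (fun m => _) = cst 0%E); first exact: cvg_cst.
    apply/funext => m; apply/eqP; rewrite eq_le L1norm_pos andbT -fz -[leRHS]mul1e.
    apply: le_L1norm => [|||x _]; [by []| |exact: mf|].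
      by apply: mfunCB; [exact: mfunC_walsh_sum|exact: mf].
    by rewrite ps0 sub0r normcNr mul1r.
  move=> m _; rewrite (eq_L1norm (g := fun=> 0)); last by move=> x _; exact: ps0.
  by rewrite L1norm_cst0 fz mule0.
have [g [delta [Lg gf cg bg]]] := subseries_approximation ha e0 N0 Nlt hE hL Lf fnz.
by exists g, delta; split; last split; last split.
Qed.
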